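(* There is a universal constant $\kappa>0$ such that the following holds. Let $\mathbf{X}$ be a zero-mean weakly stationary real process with absolutely summable autocovariance, power spectral density $S_{xx}$ and power $P(\mathbf{X})=\mathbb{E}[X_t^2]=\langle S_{xx}\rangle>0$. Let $m\ge 1$ and $\mathbf{b}=(b_0,\dots,b_{m-1})\in\mathbb{R}^m\setminus\{0\}$. Draw $U$ from the Haar (uniform) probability measure on the orthogonal group $O(m)$ and define the FIR impulse response $\mathbf{h}'$ by $h'_i=(U\mathbf{b})_i$ for $i=0,\dots,m-1$ and $h'_i=0$ otherwise. Let $$\rho^U_{\mathbf{X}\to\mathbf{Y}}=\frac{\langle S_{xx}\,|\widehat{h'}|^2\rangle}{\langle S_{xx}\rangle\,\langle|\widehat{h'}|^2\rangle}$$ be the spectral dependency ratio of the system $\mathbf{X}\mapsto\mathbf{h}'*\mathbf{X}$. Then for every $\varepsilon>0$, $$\big|\rho^U_{\mathbf{X}\to\mathbf{Y}}-1\big|\le \frac{2\varepsilon}{P(\mathbf{X})}\max_{\nu\in\mathcal{I}}S_{xx}(\nu)$$ holds with probability at least $1-\exp(-\kappa(m-1)\varepsilon^2)$.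
   Context: $\mathcal{I}=[-1/2,1/2]$, $\langle f\rangle=\int_{\mathcal{I}}f(\nu)\,d\nu$, $\widehat{a}(\nu)=\sum_t a_t e^{-\mathbf{i}2\pi\nu t}$. For a zero-mean weakly stationary process with absolutely summable autocovariance $C_{xx}(\tau)=\mathbb{E}[X_tX_{t+\tau}]$, the power spectral density is $S_{xx}=\widehat{C_{xx}}$ (a continuous function). Note $\langle|\widehat{h'}|^2\rangle=\|\mathbf{h}'\|_2^2=\|\mathbf{b}\|_2^2$ and $\langle S_{xx}|\widehat{h'}|^2\rangle=\mathbb{E}[Y_t^2]$ for $\mathbf{Y}=\mathbf{h}'*\mathbf{X}$. *)

(* Defs.v *)
From HB Require Import structures.
From mathcomp Require Import all_boot all_order all_algebra.
From mathcomp Require Import all_classical all_reals all_analysis.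
Set Implicit Arguments. Unset Strict Implicit. Unset Printing Implicit Defensive.
Import Order.TTheory GRing.Theory Num.Theory.
Import numFieldNormedType.Exports.
Local Open Scope classical_set_scope.
Local Open Scope ring_scope.

Section Defs.
Variable R : realType.

Definition freqI : set R := `[(- (2^-1)) , 2^-1]%classic.

Definition avgI (f : R -> R) : R :=
  fine (\int[@lebesgue_measure R]_(x in freqI) (f x)%:E)%E.

Definition symsum (a : int -> R) (N : nat) : R :=
  \sum_(i < (N + N).+1) a (i%:Z - N%:Z).

Definition abs_summable (a : int -> R) : Prop :=
  cvgn (symsum (fun t => `|a t|)).

(* Power spectral density S(nu) = sum_tau C(tau) e^{-i 2 pi nu tau}.
   For an (even) autocovariance the imaginary part vanishes, so this is
   the real series  sum_tau C(tau) cos(2 pi nu tau). *)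
Definition psd (C : int -> R) (nu : R) : R :=
  limn (symsum (fun t => C t * cos (2 * pi * nu * t%:~R))).

Definition weakly_stationary d (Omega : measurableType d)
    (P : probability Omega R) (X : int -> {RV P >-> R}) (C : int -> R) : Prop :=
  (forall t, P.-integrable [set: Omega] (EFin \o X t)) /\
  (forall t, P.-integrable [set: Omega] (fun w => ((X t w) ^+ 2)%:E)) /\
  (forall t, ('E_P[X t] = 0)%E) /\
  (forall t tau, ('E_P[fun w => (X t w * X (t + tau) w)%R] = (C tau)%:E)%E).

Definition orthogonal_mx (m : nat) : set 'M[R]_m :=
  [set U | U^T *m U = 1%:M /\ U *m U^T = 1%:M].

Definition MxBorel (m : nat) := g_sigma_algebraType (@open 'M[R]_m).

Definition haar_Om (m : nat) (mu : probability (MxBorel m) R) : Prop :=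
  mu (@orthogonal_mx m : set (MxBorel m)) = 1%E /\
  forall Q, @orthogonal_mx m Q ->
    forall A : set (MxBorel m), measurable A ->
      mu ((fun U : MxBorel m => (Q *m U : MxBorel m)) @^-1` A) = mu A.

(* |\hat h(nu)|^2 for the real FIR filter h_k = v_k (k < m), 0 otherwise *)
Definition fir_gain2 (m : nat) (v : 'cV[R]_m) (nu : R) : R :=
  (\sum_(k < m) v k 0 * cos (2 * pi * nu * k%:R)) ^+ 2 +
  (\sum_(k < m) v k 0 * sin (2 * pi * nu * k%:R)) ^+ 2.

Definition sdr (C : int -> R) (m : nat) (U : 'M[R]_m) (b : 'cV[R]_m) : R :=
  avgI (fun nu => psd C nu * fir_gain2 (U *m b) nu) /
  (avgI (psd C) * avgI (fir_gain2 (U *m b))).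

End Defs.

(* Main.v *)
(** Put [u := U b / |b|], let [T] be the Toeplitz matrix of the autocovariance and
    [M] the supremum of the spectral density.  By Fourier inversion the spectral
    dependency ratio is [u^T T u / C 0], and [A := T / M] satisfies [0 <= A <= 1]
    and has constant diagonal [C 0 / M], so everything reduces to the
    concentration of [f := u^T A u - C 0 / M] for [u] uniform on the sphere.

    For a Givens rotation [G_ij] by a small angle, [(U, G_ij U)] is an
    exchangeable pair, and because the diagonal of [A] is constant, [f] is an exact
    eigenvector of the averaging over all [G_ij].  Hence, up to normalisation,
    [m E(f phi(f))] is a sum of [E((f - f') (phi(f) - phi(f')))], while
    [sum_ij (f - f')^2] is uniformly bounded because [|A u| <= 1].
    Taking [phi] an odd power bounds the even moments of [f], which gives the
    Gaussian tail [2 exp(- m t^2 / 100)].  The theorem has no factor in front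
    of the exponential, so for small [m t^2] the tail bound is useless and a lower
    bound on [P(|f| <= t)] of order [m t^2] is needed; it follows from the same
    identity with [phi] the truncation at height [t / 6]. *)

Require Import Defs.
From HB Require Import structures.
From mathcomp Require Import all_boot all_order all_algebra.
From mathcomp Require Import all_classical all_reals all_analysis.
From mathcomp Require Import measurable_realfun ring lra zify.
Set Implicit Arguments. Unset Strict Implicit. Unset Printing Implicit Defensive.
Import Order.TTheory GRing.Theory Num.Theory.
Import numFieldNormedType.Exports.
Local Open Scope classical_set_scope.
Local Open Scope ring_scope.

(** * Quadratic forms and Givens rotations *)

Section Dot.
Variables (R : comNzRingType) (m : nat).
Implicit Types (u v w : 'cV[R]_m) (A : 'M[R]_m).

Definition dot u v : R := \sum_k u k 0 * v k 0.

Definition qform A u : R := dot u (A *m u).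

Lemma dotE u v : dot u v = (u^T *m v) 0 0.
Proof. by rewrite mxE; apply: eq_bigr => k _; rewrite mxE. Qed.

Lemma dotC u v : dot u v = dot v u.
Proof. by apply: eq_bigr => k _; rewrite mulrC. Qed.

Lemma dotDl u v w : dot (u + v) w = dot u w + dot v w.
Proof. by rewrite -big_split; apply: eq_bigr => k _; rewrite mxE mulrDl. Qed.

Lemma dotZl a u v : dot (a *: u) v = a * dot u v.
Proof. by rewrite mulr_sumr; apply: eq_bigr => k _; rewrite mxE mulrA. Qed.

Lemma dotDr u v w : dot w (u + v) = dot w u + dot w v.
Proof. by rewrite dotC dotDl !(dotC w). Qed.

Lemma dotZr a u v : dot v (a *: u) = a * dot v u.
Proof. by rewrite dotC dotZl (dotC v). Qed.

Lemma dot_delta i v : dot (delta_mx i 0) v = v i 0.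
Proof.
rewrite /dot (bigD1 i) //= mxE !eqxx mul1r big1 ?addr0// => k ki.
by rewrite mxE (negPf ki) mul0r.
Qed.

Lemma dot_mulmx A u v : dot u (A *m v) = dot (A^T *m u) v.
Proof. by rewrite !dotE trmx_mul trmxK mulmxA. Qed.

Lemma dot_orthogonal (U : 'M[R]_m) u v :
  U^T *m U = 1%:M -> dot (U *m u) (U *m v) = dot u v.
Proof. by move=> UU; rewrite dot_mulmx mulmxA UU mul1mx. Qed.

Lemma qformD A u w : A^T = A ->
  qform A (u + w) = qform A u + 2 * dot w (A *m u) + qform A w.
Proof.
move=> As; rewrite /qform mulmxDr dotDl !dotDr.
rewrite (dot_mulmx A u w) As (dotC _ w); ring.
Qed.

Lemma qformZ A a u : qform A (a *: u) = a ^+ 2 * qform A u.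
Proof. by rewrite /qform -scalemxAr dotZl dotZr; ring. Qed.

Lemma qform_scale A a u : qform (a *: A) u = a * qform A u.
Proof. by rewrite /qform -scalemxAl dotZr. Qed.

End Dot.

(** * Plane rotations and the change of a quadratic form under them *)

Section Givens.
Variables (R : comNzRingType) (m : nat).
Implicit Types (u : 'cV[R]_m) (A : 'M[R]_m) (i j : 'I_m) (c s : R).

(** The rotation of the coordinate plane [i], [j] with cosine [c] and sine [s], written as a
    perturbation of the identity so that a quadratic form can be expanded in the increment. It is a
    rotation only for [i != j], which is why all later sums run over [j != i]. *)
Definition givens c s i j : 'M[R]_m :=
  1%:M + (c - 1) *: (delta_mx i i + delta_mx j j)
       + s *: (delta_mx i j - delta_mx j i).

Definition givens_incr c s i j u : 'cV[R]_m :=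
  ((c - 1) * u i 0 + s * u j 0) *: delta_mx i 0
  + ((c - 1) * u j 0 - s * u i 0) *: delta_mx j 0.

Lemma delta_mulcV i j u : delta_mx i j *m u = u j 0 *: delta_mx i 0.
Proof.
apply/matrixP => k l; rewrite !mxE (bigD1 j) //= !mxE eqxx andbT.
rewrite big1 => [|h hj]; last by rewrite mxE (negPf hj) andbF mul0r.
by rewrite addr0 (ord1 l) eqxx andbT mulrC.
Qed.

Lemma givens_mul c s i j u : givens c s i j *m u = u + givens_incr c s i j u.
Proof.
rewrite /givens /givens_incr !mulmxDl mul1mx -!scalemxAl !mulmxDl mulNmx.
rewrite !delta_mulcV -addrA; congr (_ + _).
rewrite !scalerDr !scalerN !scalerA !scalerDl scaleNr.
by rewrite -!addrA; congr (_ + _); rewrite addrCA; congr (_ + _).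
Qed.

Lemma givens_tr c s i j : (givens c s i j)^T = givens c s j i.
Proof.
by apply/matrixP => k l; rewrite !mxE ![(l == _) && _]andbC [l == k]eq_sym; ring.
Qed.

(** Exchanging the two indices reverses the angle, so the two rotations are inverse to each
    other. *)
Lemma givens_orthogonal c s i j : i != j -> c ^+ 2 + s ^+ 2 = 1 ->
  givens c s i j *m givens c s j i = 1%:M.
Proof.
move=> ij cs; apply/matrixP => k l.
(* It is enough to compare actions on vectors; the entries come back by applying both sides to basis
   vectors. *)
suff H u : givens c s i j *m (givens c s j i *m u) = u.
  have := congr1 (fun v : 'cV_m => v k 0) (H (delta_mx l 0)).
  rewrite mulmxA -colE !mxE => ->.
  by rewrite eqxx andbT.
have ji : j != i by rewrite eq_sym.
rewrite !givens_mul; apply/matrixP => k' l'; rewrite (ord1 l') !mxE.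
rewrite !eqxx (negPf ij) (negPf ji) /=.
have ss : s * s = 1 - c * c by rewrite -!expr2 -cs; ring.
have [->|ki] := eqVneq k' i.
  by rewrite (negPf ij) /=; ring: ss.
have [->|kj] := eqVneq k' j; rewrite /=.
  by ring: ss.
by ring.
Qed.

(** The increment is supported on two coordinates, so only one 2 by 2 block of [A] enters. *)
Lemma qform_givens_incr A c s i j u : A^T = A ->
  qform A (givens_incr c s i j u)
  = ((c - 1) * u i 0 + s * u j 0) ^+ 2 * A i i
    + ((c - 1) * u j 0 - s * u i 0) ^+ 2 * A j j
    + 2 * ((c - 1) * u i 0 + s * u j 0) * ((c - 1) * u j 0 - s * u i 0) * A i j.
Proof.
move=> As; rewrite /givens_incr qformD // !qformZ.
rewrite -!scalemxAr !dotZr !dotZl /qform -!colE !dot_delta !mxE.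
have -> : A j i = A i j by rewrite -{1}As mxE.
by ring.
Qed.

Lemma dot_givens_incr c s i j u v :
  dot (givens_incr c s i j u) v
  = ((c - 1) * u i 0 + s * u j 0) * v i 0
    + ((c - 1) * u j 0 - s * u i 0) * v j 0.
Proof. by rewrite dotDl !dotZl !dot_delta. Qed.

End Givens.

(** * Double sums over pairs of indices *)

Section DoubleSum.
Variables (R : realFieldType) (m : nat).
Implicit Types (x y : 'I_m -> R) (B C : 'I_m -> 'I_m -> R).

Lemma sum2D B C : \sum_(i < m) \sum_(j < m) (B i j + C i j)
  = \sum_(i < m) \sum_(j < m) B i j + \sum_(i < m) \sum_(j < m) C i j.
Proof. by rewrite -big_split; apply: eq_bigr => i _; rewrite big_split. Qed.

Lemma sum2Z a B :
  \sum_(i < m) \sum_(j < m) (a * B i j) = a * \sum_(i < m) \sum_(j < m) B i j.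
Proof. by rewrite mulr_sumr; apply: eq_bigr => i _; rewrite mulr_sumr. Qed.

Lemma sum2l x : \sum_(i < m) \sum_(j < m) x i = m%:R * \sum_i x i.
Proof.
by rewrite mulr_sumr; apply: eq_bigr => i _; rewrite sumr_const card_ord mulr_natl.
Qed.

Lemma sum2r x : \sum_(i < m) \sum_(j < m) x j = m%:R * \sum_i x i.
Proof. by rewrite sumr_const card_ord mulr_natl. Qed.

Lemma sum2_mul x y :
  \sum_(i < m) \sum_(j < m) x i * y j = (\sum_i x i) * (\sum_j y j).
Proof. by rewrite mulr_suml; apply: eq_bigr => i _; rewrite mulr_sumr. Qed.

Lemma sum2_antisym B : (forall i j, B j i = - B i j) ->
  \sum_(i < m) \sum_(j < m) B i j = 0.
Proof.
move=> BN; set S := LHS.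
suff : S = - S by lra.
rewrite {1}/S exchange_big -sumrN; apply: eq_bigr => i _.
by rewrite -sumrN; apply: eq_bigr => j _.
Qed.

Lemma sum2_offdiag B :
  \sum_(i < m) \sum_(j < m | j != i) B i j
  = \sum_(i < m) \sum_(j < m) B i j - \sum_(i < m) B i i.
Proof.
rewrite -sumrB; apply: eq_bigr => i _.
by rewrite [\sum_(j < m) B i j](bigD1 i) //= addrAC subrr add0r.
Qed.

(** Passing to the full square of indices costs nothing when the added diagonal is nonnegative, and
    full double sums have closed forms. *)
Lemma ler_sum2_offdiag B C : (forall i j, j != i -> B i j <= C i j) ->
  (forall i, 0 <= C i i) ->
  \sum_(i < m) \sum_(j < m | j != i) B i j <= \sum_(i < m) \sum_(j < m) C i j.
Proof.
move=> BC C0; apply: ler_sum => i _.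
rewrite [leRHS](bigD1 i) //= ler_wpDl // ler_sum // => j; exact: BC.
Qed.

End DoubleSum.

(** * First and second moments of the increments over all plane rotations *)

Section GivensSum.
Variables (R : realFieldType) (m : nat).
Implicit Types (u : 'cV[R]_m) (A : 'M[R]_m) (i j : 'I_m) (c s : R).

Lemma qform_sum A u :
  \sum_(i < m) \sum_(j < m) A i j * (u i 0 * u j 0) = qform A u.
Proof.
apply: eq_bigr => i _; rewrite mxE mulr_sumr; apply: eq_bigr => j _; ring.
Qed.

(* A constant diagonal makes the centred form an exact eigenvector of the
   averaging over Givens rotations; in general the diagonal and off-diagonal
   parts have slightly different eigenvalues. *)
Lemma sum_givens_qform A d c s u :
  A^T = A -> (forall i, A i i = d) -> c ^+ 2 + s ^+ 2 = 1 -> dot u u = 1 ->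
  \sum_(i < m) \sum_(j < m | j != i)
     (qform A u - qform A (givens c s i j *m u))
  = 4 * (1 - c) * (m%:R - (1 - c)) * (qform A u - d).
Proof.
move=> As Ad cs u1; set z := A *m u.
have ss : s * s = 1 - c * c by rewrite -!expr2 -cs; ring.
pose x i := u i 0 * z i 0; pose y i := u i 0 * u i 0.
have xE : \sum_i x i = qform A u by [].
have yE : \sum_i y i = 1 by [].
(* The terms odd in the angle: antisymmetric in [i], [j], hence zero in the full double sum. *)
pose N i j := - (2 * s) * (u j 0 * z i 0 - u i 0 * z j 0)
              - 2 * s * (c - 1) * A i j * (y j - y i).
pose w i := 2 * (1 - c) * x i + (- (2 * d * (1 - c))) * y i.
have wE : \sum_i w i = 2 * (1 - c) * (qform A u - d).
  by rewrite big_split /= -!mulr_sumr xE yE; ring.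
(* [B] expands the increment into terms in one index, a term that sums to the quadratic form itself,
   and the antisymmetric part. The formula also makes sense for [i = j], so the full sum is computed
   and the diagonal removed. *)
pose B i j := w i + w j + (- (4 * c * (c - 1))) * (A i j * (u i 0 * u j 0)) + N i j.
transitivity (\sum_(i < m) \sum_(j < m | j != i) B i j).
  apply: eq_bigr => i _; apply: eq_bigr => j ji.
  rewrite givens_mul qformD // qform_givens_incr // dot_givens_incr -/z !Ad.
  by rewrite /B /N /w /x /y; ring: ss.
rewrite sum2_offdiag.
have -> : \sum_(i < m) B i i = 4 * (1 - c) * (qform A u - d) - 4 * c * (c - 1) * d.
  transitivity (\sum_(i < m) (2 * w i + (- (4 * c * (c - 1) * d)) * y i)).
    by apply: eq_bigr => i _; rewrite /B /N Ad /y; ring.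
  by rewrite big_split /= -!mulr_sumr wE yE; ring.
rewrite /B (sum2D _ N) (sum2D (fun i j => w i + w j)) (sum2D (fun i j => w i)).
rewrite sum2Z qform_sum sum2l sum2r wE sum2_antisym; first by ring.
move=> i j; have Aji : A j i = A i j by rewrite -{1}As mxE.
by rewrite /N Aji; ring.
Qed.

Lemma dot_sqr_ge0 u : 0 <= dot u u.
Proof. by apply: sumr_ge0 => i _; rewrite -expr2 sqr_ge0. Qed.

Lemma dot_gt0 u : u != 0 -> 0 < dot u u.
Proof.
move=> u0; rewrite lt_def dot_sqr_ge0 andbT; apply: contra u0.
rewrite psumr_eq0 => [/allP H|k _]; last by rewrite -expr2 sqr_ge0.
apply/eqP/matrixP => k l; rewrite (ord1 l) mxE.
by have := H k (mem_index_enum _); rewrite /= mulf_eq0 orbb => /eqP.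
Qed.

(** Positivity of the form at [u - A u] gives [2 |A u|^2 <= q(u) + q(A u)], and the upper bound on
    the form makes the right side at most [|u|^2 + |A u|^2]. *)
Lemma dot_mulmx_le A u : A^T = A ->
  (forall v, 0 <= qform A v <= dot v v) -> dot (A *m u) (A *m u) <= dot u u.
Proof.
move=> As A01.
have /andP[+ _] := A01 (u + (-1) *: (A *m u)).
rewrite qformD // qformZ sqrrN expr1n mul1r dotZl.
have /andP[_] := A01 (A *m u); have /andP[_] := A01 u.
lra.
Qed.

(** To first order in the angle the increment is a multiple of [u_j z_i - u_i z_j] with [z = A u].
    The sum of the squares of these is at most 2, which contributes at most [48 (1 - c)]. The
    remainder is of order [m (1 - c)^2], and the smallness hypothesis on [1 - c] brings it below
    [2 (1 - c)]. *)
Lemma sum_givens_qform_sqr A c s u :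
  A^T = A -> (forall v, 0 <= qform A v <= dot v v) ->
  c ^+ 2 + s ^+ 2 = 1 -> dot u u = 1 -> 0 <= 1 - c ->
  48 * m%:R * (1 - c) <= 1 ->
  \sum_(i < m) \sum_(j < m | j != i)
     (qform A u - qform A (givens c s i j *m u)) ^+ 2 <= 50 * (1 - c).
Proof.
move=> As A01 cs u1 c0 c1; set z := A *m u.
have ss : s * s = 1 - c * c by rewrite -!expr2 -cs; ring.
have zz : dot z z <= 1 by rewrite -u1; exact: dot_mulmx_le.
pose y i := u i 0 ^+ 2; pose t i := z i 0 ^+ 2.
have y0 i : 0 <= y i by exact: sqr_ge0.
have t0 i : 0 <= t i by exact: sqr_ge0.
have yE : \sum_i y i = 1.
  by rewrite -[RHS]u1; apply: eq_bigr => i _; rewrite /y expr2.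
have tE : \sum_i t i <= 1.
  by apply: le_trans zz; apply: ler_sum => i _; rewrite /t expr2.
have y1 i : y i <= 1.
  by rewrite -yE (bigD1 i) //= lerDl sumr_ge0.
pose w i := y i * t i + y i ^+ 2.
have wE : \sum_i w i <= 2.
  rewrite big_split /=; apply: lerD.
    by apply: le_trans tE; apply: ler_sum => i _; rewrite ler_piMl.
  by rewrite -yE; apply: ler_sum => i _; rewrite expr2 ler_piMl.
have w0 i : 0 <= w i.
  by apply: addr_ge0; [exact: mulr_ge0 | exact: exprn_ge0].
pose X i j := (u j 0 * z i 0 - u i 0 * z j 0) ^+ 2.
(* Lagrange's identity: the sum is [2 (|u|^2 |z|^2 - (u . z)^2)]. *)
have XE : \sum_(i < m) \sum_(j < m) X i j <= 2.
  have -> : \sum_(i < m) \sum_(j < m) X i j =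
     \sum_(i < m) \sum_(j < m) (t i * y j + y i * t j
         + (-2) * ((u i 0 * z i 0) * (u j 0 * z j 0))).
    by apply: eq_bigr => i _; apply: eq_bigr => j _; rewrite /X /t /y; ring.
  rewrite !sum2D sum2Z !sum2_mul yE; have := sqr_ge0 (\sum_i u i 0 * z i 0).
  by rewrite expr2; lra.
(* The bound comes from [(x - y - q)^2 <= 3 (x^2 + y^2 + q^2)], applied to the second-order linear
   part, the first-order part and the quadratic part of the increment. *)
pose B i j := 12 * s ^+ 2 * X i j + 24 * (1 - c) ^+ 2 * (w i + w j).
have B0 i j : 0 <= B i j.
  by apply: addr_ge0; apply: mulr_ge0;
    rewrite ?addr_ge0 // ?sqr_ge0 // mulr_ge0 ?sqr_ge0.
apply: (@le_trans _ _ (\sum_(i < m) \sum_(j < m) B i j)).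
  apply: ler_sum2_offdiag => // i j ji.
  (* The squared length of the displacement, which bounds the quadratic part because the form lies
     between 0 and the squared norm. *)
  have incr2 : dot (givens_incr c s i j u) (givens_incr c s i j u)
      = 2 * (1 - c) * (y i + y j).
    rewrite dot_givens_incr /givens_incr !mxE !eqxx (negPf ji) eq_sym (negPf ji) /=.
    by rewrite /y; ring: ss.
  have /andP[] := A01 (givens_incr c s i j u); rewrite incr2.
  rewrite givens_mul qformD // dot_givens_incr -/z.
  move: (qform A (givens_incr c s i j u)) => q q0 q1.
  have q2 : q ^+ 2 <= 8 * (1 - c) ^+ 2 * (y i ^+ 2 + y j ^+ 2).
    apply: (@le_trans _ _ ((2 * (1 - c) * (y i + y j)) ^+ 2)).
      by rewrite ler_sqr // nnegrE ?mulr_ge0 // addr_ge0.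
    have -> : 8 * (1 - c) ^+ 2 * (y i ^+ 2 + y j ^+ 2) =
      (2 * (1 - c) * (y i + y j)) ^+ 2 + (2 * (1 - c) * (y i - y j)) ^+ 2 by ring.
    by rewrite lerDl sqr_ge0.
  set p1 := u j 0 * z i 0 - u i 0 * z j 0.
  set p2 := u i 0 * z i 0 + u j 0 * z j 0.
  have p2E : p2 ^+ 2 <= 2 * (y i * t i + y j * t j).
    have := sqr_ge0 (u i 0 * z i 0 - u j 0 * z j 0).
    by rewrite /p2 /y /t; lra.
  have -> : qform A u - (qform A u + 2 * (((c - 1) * u i 0 + s * u j 0) * z i 0 +
    ((c - 1) * u j 0 - s * u i 0) * z j 0) + q)
    = 2 * (1 - c) * p2 - 2 * s * p1 - q by rewrite /p1 /p2; ring.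
  apply: (@le_trans _ _ (12 * s ^+ 2 * p1 ^+ 2 + 12 * (1 - c) ^+ 2 * p2 ^+ 2
             + 3 * q ^+ 2)).
    have h1 := sqr_ge0 (2 * (1 - c) * p2 + 2 * s * p1).
    have h2 := sqr_ge0 (2 * (1 - c) * p2 + q).
    have h3 := sqr_ge0 (2 * s * p1 - q).
    by lra.
  rewrite /B /w -/p1.
  have : 12 * (1 - c) ^+ 2 * p2 ^+ 2
         <= 12 * (1 - c) ^+ 2 * (2 * (y i * t i + y j * t j)).
    by rewrite ler_wpM2l // mulr_ge0 // sqr_ge0.
  by rewrite /X -/p1; lra.
rewrite /B sum2D !sum2Z sum2D sum2l sum2r.
have : 12 * s ^+ 2 * (\sum_(i < m) \sum_(j < m) X i j) <= 12 * s ^+ 2 * 2.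
  by rewrite ler_wpM2l // mulr_ge0 // sqr_ge0.
have : 24 * (1 - c) * (1 - c) * (m%:R * \sum_i w i)
       <= 24 * (1 - c) * (1 - c) * (m%:R * 2).
  by rewrite ler_wpM2l ?mulr_ge0 // ler_wpM2l.
have : (1 - c) * (48 * m%:R * (1 - c)) <= (1 - c) * 1 by rewrite ler_wpM2l.
rewrite [s ^+ 2]expr2 ss => h1 h2 h3.
have h4 := mulr_ge0 c0 c0.
by lra.
Qed.
End GivensSum.

(** * Expectation under Haar measure *)

Lemma Rintegral_sum d (T : measurableType d) (R : realType)
    (mu : {measure set T -> \bar R}) (D : set T) I (r : seq I) (P : pred I)
    (F : I -> T -> R) : measurable D ->
  (forall i, P i -> mu.-integrable D (EFin \o F i)) ->
  Rintegral mu D (fun x => \sum_(i <- r | P i) F i x)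
  = \sum_(i <- r | P i) Rintegral mu D (F i).
Proof.
move=> mD iF; elim: r => [|i r IH].
  rewrite big_nil -[RHS](mul0r (fine (mu D))) -Rintegral_cst //.
  by apply: eq_Rintegral => x _; rewrite big_nil.
rewrite big_cons; case: ifP => Pi.
  rewrite -IH -RintegralD //; first last.
  - rewrite (_ : _ \o _ = (fun x => \sum_(j <- r | P j) (F j x)%:E)%E).
      exact: integrable_sum.
    by apply/funext => x /=; rewrite sumEFin.
  - exact: iF.
  by apply: eq_Rintegral => x _; rewrite big_cons Pi.
by rewrite -IH; apply: eq_Rintegral => x _; rewrite big_cons Pi.
Qed.

(** * Closure properties of bounded measurable functions *)

Section BoundedMeasurable.
Context d (T : measurableType d) (R : realType).
Variable D : set T.
Implicit Types (Y Z : T -> R) (A : set T).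

(** Boundedness is asked on [D] only: polynomials in the entries are bounded on the orthogonal group
    but in general not on all matrices. *)
Definition bounded_mfun Z :=
  measurable_fun setT Z /\ exists M, forall x, D x -> `|Z x| <= M.

Lemma bounded_mfun_cst a : bounded_mfun (cst a).
Proof. by split; [exact: measurable_cst | exists `|a|]. Qed.

Lemma bounded_mfunD Y Z :
  bounded_mfun Y -> bounded_mfun Z -> bounded_mfun (fun U => Y U + Z U).
Proof.
move=> [mY [M YM]] [mZ [N ZN]]; split; first exact: measurable_funD.
exists (M + N) => U DU; apply: le_trans (ler_normD _ _) _.
by apply: lerD; [exact: YM | exact: ZN].
Qed.

Lemma bounded_mfunM Y Z :
  bounded_mfun Y -> bounded_mfun Z -> bounded_mfun (fun U => Y U * Z U).
Proof.
move=> [mY [M YM]] [mZ [N ZN]]; split; first exact: measurable_funM.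
exists (M * N) => U DU; rewrite normrM; apply: ler_pM => //.
  exact: YM.
exact: ZN.
Qed.

Lemma bounded_mfunN Y : bounded_mfun Y -> bounded_mfun (fun U => - Y U).
Proof.
move=> bY; rewrite (_ : (fun _ => _) = (fun U => cst (-1) U * Y U)); last first.
  by apply/funext => U; rewrite /= mulN1r.
by apply: bounded_mfunM => //; exact: bounded_mfun_cst.
Qed.

Lemma bounded_mfunB Y Z :
  bounded_mfun Y -> bounded_mfun Z -> bounded_mfun (fun U => Y U - Z U).
Proof. by move=> bY bZ; apply: bounded_mfunD => //; exact: bounded_mfunN. Qed.

Lemma bounded_mfunZ a Y : bounded_mfun Y -> bounded_mfun (fun U => a * Y U).
Proof. by apply: bounded_mfunM; exact: bounded_mfun_cst. Qed.

Lemma bounded_mfunX Y n : bounded_mfun Y -> bounded_mfun (fun U => Y U ^+ n).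
Proof.
move=> [mY [M YM]]; split; first exact: measurable_funX.
exists (M ^+ n) => U DU; rewrite normrX lerXn2r ?nnegrE //.
  by apply: le_trans (YM U DU).
exact: YM.
Qed.

Lemma bounded_mfun_sum I (r : seq I) (P : pred I) (F : I -> T -> R) :
  (forall i, P i -> bounded_mfun (F i)) ->
  bounded_mfun (fun U => \sum_(i <- r | P i) F i U).
Proof.
move=> bF; elim: r => [|i r IH].
  rewrite (_ : (fun _ => _) = cst 0); first exact: bounded_mfun_cst.
  by apply/funext => U; rewrite big_nil.
have [Pi|Pi] := boolP (P i).
  rewrite (_ : (fun _ => _) = (fun U => F i U + \sum_(i <- r | P i) F i U)).
    by apply: bounded_mfunD => //; exact: bF.
  by apply/funext => U; rewrite big_cons Pi.
rewrite (_ : (fun _ => _) = (fun U => \sum_(i <- r | P i) F i U)) //.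
by apply/funext => U; rewrite big_cons (negPf Pi).
Qed.

Lemma bounded_mfun_norm Y : bounded_mfun Y -> bounded_mfun (fun U => `|Y U|).
Proof.
move=> [mY [M YM]]; split; first exact: measurableT_comp.
by exists M => U DU; rewrite normr_id; exact: YM.
Qed.

Lemma bounded_mfun_max Y Z :
  bounded_mfun Y -> bounded_mfun Z -> bounded_mfun (fun U => Num.max (Y U) (Z U)).
Proof.
move=> [mY [M YM]] [mZ [N ZN]]; split; first exact: measurable_maxr.
exists (M + N) => U DU.
have M0 : 0 <= M by apply: le_trans (YM U DU).
have N0 : 0 <= N by apply: le_trans (ZN U DU).
have := YM U DU; have := ZN U DU; rewrite /Num.max; case: ifP; lra.
Qed.

Lemma bounded_mfun_min Y Z :
  bounded_mfun Y -> bounded_mfun Z -> bounded_mfun (fun U => Num.min (Y U) (Z U)).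
Proof.
move=> [mY [M YM]] [mZ [N ZN]]; split; first exact: measurable_minr.
exists (M + N) => U DU.
have M0 : 0 <= M by apply: le_trans (YM U DU).
have N0 : 0 <= N by apply: le_trans (ZN U DU).
have := YM U DU; have := ZN U DU; rewrite /Num.min; case: ifP; lra.
Qed.

Lemma bounded_mfun_indic (A : set (T)) : measurable A ->
  bounded_mfun (\1_A : T -> R).
Proof.
move=> mA; split; first exact: measurable_indic.
exists 1 => U _; rewrite indicE.
by case: (_ \in _); rewrite /= ?normr1 ?normr0.
Qed.

Variable mu : {measure set T -> \bar R}.
Hypotheses (mD : measurable D) (muD : (mu D < +oo)%E).

Lemma bounded_mfun_integrable Z :
  bounded_mfun Z -> mu.-integrable D (EFin \o Z).
Proof.
move=> [mZ [M ZM]]; apply: measurable_bounded_integrable => //.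
- exact: measurable_funTS.
- exists M; split; rewrite ?num_real // => N MN x Dx.
  by apply: le_trans (ZM x Dx) (ltW MN).
Qed.

End BoundedMeasurable.

Lemma continuous_sum (R : numFieldType) (T : topologicalType) I (r : seq I)
    (F : I -> T -> R) :
  (forall i, continuous (F i)) -> continuous (fun x => \sum_(i <- r) F i x).
Proof.
move=> cF; elim: r => [|i r IH].
  rewrite (_ : (fun _ => _) = cst 0); first by move=> x; exact: cvg_cst.
  by apply/funext => x; rewrite big_nil.
rewrite (_ : (fun _ => _) = (fun x => F i x + \sum_(i <- r) F i x)); last first.
  by apply/funext => x; rewrite big_cons.
by move=> x; apply: cvgD; [exact: cF | exact: IH].
Qed.

(** * Measurability and left invariance on the orthogonal group *)

Section Haar.
Variables (R : realType) (m : nat).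
Local Notation D := (@orthogonal_mx R m : set (MxBorel R m)).

Lemma measurable_coord (i j : 'I_m) :
  measurable_fun [set: MxBorel R m] (fun U : MxBorel R m => (U : 'M[R]_m) i j).
Proof.
apply: (measurability _ (RGenOpens.measurableE R)).
move=> _ [_ [a [b ->]] <-]; rewrite setTI; apply: sub_sigma_algebra.
by move/continuousP : (@coord_continuous R m m i j); apply; exact: interval_open.
Qed.

Lemma measurable_mulmxl (Q : 'M[R]_m) :
  measurable_fun [set: MxBorel R m]
    ((fun U => Q *m U) : MxBorel R m -> MxBorel R m).
Proof.
apply: (@measurability _ _ _ (MxBorel R m) _ _ (@open 'M[R]_m)) => //.
move=> _ [B Bop <-]; rewrite setTI; apply: sub_sigma_algebra.
suff /continuousP : continuous (fun U : 'M[R]_m => Q *m U) by apply.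
move=> U A [P /= PQ PA].
(* Neighbourhoods of a matrix are generated entrywise, so continuity reduces to finitely many scalar
   conditions. *)
have : \forall V \near U, forall ij : 'I_m * 'I_m, P ij.1 ij.2 ((Q *m V) ij.1 ij.2).
  apply: (@filter_forall _ _ (fun (ij : 'I_m * 'I_m) (V : 'M[R]_m) =>
            P ij.1 ij.2 ((Q *m V) ij.1 ij.2)) (nbhs U)) => -[i j] /=.
  have : continuous (fun V : 'M[R]_m => (Q *m V) i j).
    have -> : (fun V : 'M[R]_m => (Q *m V) i j)
         = (fun V : 'M[R]_m => \sum_k Q i k * V k j).
      by apply/funext => V; rewrite mxE.
    apply: continuous_sum => k V.
    apply: (@continuousM _ _ (fun=> Q i k) (fun V : 'M[R]_m => V k j)).
      exact: cst_continuous.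
    exact: coord_continuous.
  by move=> /(_ U); apply; exact: PQ.
move=> PV.
apply: (@filterS _ (nbhs U) _ _ _ _ PV) => V {}PV.
by apply: PA => i j; exact: (PV (i, j)).
Qed.

(** Being the zero set of a polynomial, the sum of squares of the entries of [U^T U - 1], the group
    inherits measurability from the coordinate functions. *)
Lemma orthogonal_mxE :
  D = (fun U : MxBorel R m => \sum_i \sum_j
         ((\sum_k (U : 'M[R]_m) k i * (U : 'M[R]_m) k j) - (i == j)%:R) ^+ 2)
      @^-1` [set 0].
Proof.
have gramE (U : 'M[R]_m) i j : (U^T *m U) i j = \sum_k U k i * U k j.
  by rewrite mxE; apply: eq_bigr => k _; rewrite mxE.
apply/seteqP; split => U /=.
  move=> [UU _]; apply: big1 => i _; apply: big1 => j _.
  by have /matrixP/(_ i j) := UU; rewrite gramE mxE => ->; rewrite subrr expr0n.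
move=> U0; suff UU : (U : 'M[R]_m)^T *m (U : 'M[R]_m) = 1%:M.
  by split => //; exact: mulmx1C.
apply/matrixP => i j; rewrite gramE mxE.
have /eqP := U0; rewrite psumr_eq0; last first.
  by move=> k _; apply: sumr_ge0 => l _; exact: sqr_ge0.
move=> /allP/(_ i (mem_index_enum _)) /=.
rewrite psumr_eq0; last by move=> l _; exact: sqr_ge0.
move=> /allP/(_ j (mem_index_enum _)) /=.
by rewrite sqrf_eq0 subr_eq0 => /eqP.
Qed.

Lemma measurable_orthogonal_mx : measurable D.
Proof.
rewrite orthogonal_mxE -[X in measurable X]setTI.
set f := (X in X @^-1` _).
suff mf : measurable_fun [set: MxBorel R m] f.
  by apply: mf => //; exact: measurable_set1.
apply: measurable_sum => i; apply: measurable_sum => j.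
apply: measurable_funX; apply: measurable_funB; last exact: measurable_cst.
by apply: measurable_sum => k; apply: measurable_funM; exact: measurable_coord.
Qed.

Lemma orthogonal_mx_mul (Q U : 'M[R]_m) :
  orthogonal_mx Q -> orthogonal_mx U -> orthogonal_mx (Q *m U).
Proof.
move=> [Q1 Q2] [U1 U2]; split; rewrite trmx_mul !mulmxA.
  by rewrite -(mulmxA _ _ Q) Q1 mulmx1 U1.
by rewrite -(mulmxA _ U) U2 mulmx1 Q2.
Qed.

Lemma orthogonal_mx_tr (Q : 'M[R]_m) : orthogonal_mx Q -> orthogonal_mx Q^T.
Proof. by move=> [Q1 Q2]; split; rewrite trmxK. Qed.

Local Notation bounded_rv := (bounded_mfun D).
Implicit Types Y Z : MxBorel R m -> R.

Lemma bounded_rv_mulmxl (Q : 'M[R]_m) Y : orthogonal_mx Q ->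
  bounded_rv Y -> bounded_rv (fun U => Y (Q *m U)).
Proof.
move=> oQ [mY [M YM]]; split; last first.
  by exists M => U DU; apply: YM; exact: orthogonal_mx_mul.
have := measurableT_comp mY (measurable_mulmxl Q).
by [].
Qed.

Variable mu : probability (MxBorel R m) R.
Hypothesis haar : haar_Om mu.

(** Expectation under Haar measure. The domain is restricted to the orthogonal group, which has mass
    1, so that boundedness there suffices for integrability. *)
Definition Ex Z : R := Rintegral mu D Z.

Lemma bounded_rv_integrable Z : bounded_rv Z -> mu.-integrable D (EFin \o Z).
Proof.
apply: bounded_mfun_integrable; first exact: measurable_orthogonal_mx.
by rewrite -[X in (X < _)%E]/(mu D) haar.1 ltry.
Qed.

Lemma eq_Ex Y Z : (forall U, D U -> Y U = Z U) -> Ex Y = Ex Z.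
Proof. by move=> YZ; apply: eq_Rintegral => U /set_mem; exact: YZ. Qed.

Lemma ExD Y Z : bounded_rv Y -> bounded_rv Z ->
  Ex (fun U => Y U + Z U) = Ex Y + Ex Z.
Proof.
move=> bY bZ; apply: RintegralD; [exact: measurable_orthogonal_mx| |];
  exact: bounded_rv_integrable.
Qed.

Lemma ExB Y Z : bounded_rv Y -> bounded_rv Z ->
  Ex (fun U => Y U - Z U) = Ex Y - Ex Z.
Proof.
move=> bY bZ; apply: RintegralB; [exact: measurable_orthogonal_mx| |];
  exact: bounded_rv_integrable.
Qed.

Lemma ExZ a Y : bounded_rv Y -> Ex (fun U => a * Y U) = a * Ex Y.
Proof.
move=> bY; apply: RintegralZl; [exact: measurable_orthogonal_mx|].
exact: bounded_rv_integrable.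
Qed.

Lemma Ex_cst a : Ex (cst a) = a.
Proof.
rewrite /Ex Rintegral_cst; last exact: measurable_orthogonal_mx.
by rewrite -[X in fine X]/(mu D) haar.1 mulr1.
Qed.

Lemma Ex_sum I (r : seq I) (P : pred I) (F : I -> MxBorel R m -> R) :
  (forall i, P i -> bounded_rv (F i)) ->
  Ex (fun U => \sum_(i <- r | P i) F i U) = \sum_(i <- r | P i) Ex (F i).
Proof.
move=> bF; apply: Rintegral_sum; first exact: measurable_orthogonal_mx.
by move=> i /bF; exact: bounded_rv_integrable.
Qed.

Lemma le_Ex Y Z : bounded_rv Y -> bounded_rv Z ->
  (forall U, D U -> Y U <= Z U) -> Ex Y <= Ex Z.
Proof.
move=> bY bZ; apply: le_Rintegral; [exact: measurable_orthogonal_mx| |];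
  exact: bounded_rv_integrable.
Qed.

Lemma Ex_ge0 Y : (forall U, D U -> 0 <= Y U) -> 0 <= Ex Y.
Proof. exact: Rintegral_ge0. Qed.

Lemma Ex_indic (A : set (MxBorel R m)) : measurable A -> A `<=` D ->
  (Ex \1_A)%:E = mu A.
Proof.
move=> mA AD; rewrite /Ex /Rintegral integral_indic //; last first.
  exact: measurable_orthogonal_mx.
by rewrite setIidl // fineK // fin_num_measure.
Qed.

(** Change of variables: by invariance the pushforward of [mu] under left multiplication is [mu],
    and the group is its own preimage. *)
Lemma Ex_mulmxl (Q : 'M[R]_m) Y : orthogonal_mx Q -> bounded_rv Y ->
  Ex (fun U => Y (Q *m U)) = Ex Y.
Proof.
move=> oQ bY; congr fine.
pose phi : MxBorel R m -> MxBorel R m := fun U => Q *m U.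
have mphi : measurable_fun setT phi by exact: measurable_mulmxl.
have phiD : phi @^-1` D = D.
  apply/seteqP; split => U /=; last exact: orthogonal_mx_mul.
  move=> /(orthogonal_mx_mul (orthogonal_mx_tr oQ)).
  by rewrite /phi mulmxA oQ.1 mul1mx.
have := @integral_pushforward _ _ _ _ R phi mphi mu D (EFin \o Y).
rewrite phiD => <-; first last.
- exact: measurable_orthogonal_mx.
- exact: (bounded_rv_integrable (bounded_rv_mulmxl oQ bY)).
- by apply/measurable_EFinP; case: bY.
by apply: eq_measure_integral => A mA _; exact: haar.2.
Qed.

End Haar.

(** * Concentration of quadratic forms *)

Section Truncation.
Variable R : realFieldType.
Implicit Types x y h : R.

Definition truncate h x := Num.max (- h) (Num.min x h).

Lemma truncateE h x : 0 <= h ->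
  truncate h x = if h <= x then h else if x <= - h then - h else x.
Proof.
rewrite /truncate minEle => h0; case: (leP x h) => xh; last first.
  by rewrite (ltW xh) max_r //; lra.
rewrite maxEge; case: (leP h x) => hx; last by [].
by case: (leP x (- h)); lra.
Qed.

Lemma truncate_incr h x y : 0 <= h -> y <= x ->
  0 <= truncate h x - truncate h y <= x - y.
Proof.
move=> h0 yx; rewrite !truncateE //.
by case: (leP h x) => ?; case: (leP h y) => ?; case: (leP x (- h)) => ?;
  case: (leP y (- h)) => ?; lra.
Qed.

Lemma truncate_lip h x y : 0 <= h ->
  `|truncate h x - truncate h y| <= `|x - y|.
Proof.
move=> h0; have [yx|/ltW xy] := leP y x.
  by have /andP[? ?] := truncate_incr h0 yx;
    rewrite [leRHS]ger0_norm ?subr_ge0 // ger0_norm.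
rewrite [leLHS]distrC [leRHS]distrC.
by have /andP[? ?] := truncate_incr h0 xy;
  rewrite [leRHS]ger0_norm ?subr_ge0 // ger0_norm.
Qed.

(** Beyond height [2 h], a move of at most [h] stays on the same side, at or beyond the clipping
    level. Increments of the truncation therefore live where [x] is small. *)
Lemma truncate_far h x y : 0 <= h -> `|x - y| <= h -> 2 * h < `|x| ->
  truncate h x = truncate h y.
Proof.
move=> h0; rewrite ler_distl ltr_normr !truncateE // => /andP[? ?] /orP[] ?.
  by case: (leP h x) => ?; case: (leP h y) => ?; lra.
by case: (leP h x) => ?; case: (leP h y) => ?; case: (leP x (- h)) => ?;
  case: (leP y (- h)) => ?; lra.
Qed.

(** Where clipping occurs the product is [h |x|]; elsewhere it is [x^2], and [(|x| - h)^2 >= 0]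
    applies. *)
Lemma truncate_mul_ge h x : 0 <= h -> h * `|x| - h ^+ 2 <= x * truncate h x.
Proof.
move=> h0; rewrite truncateE //; have hh := mulr_ge0 h0 h0.
case: (leP h x) => hx; last case: (leP x (- h)) => xh.
- by rewrite ger0_norm; nra.
- by rewrite ler0_norm; nra.
- have := sqr_ge0 (`|x| - h); have : x * x = `|x| * `|x|.
    by rewrite -!expr2 real_normK ?num_real.
  have := mulr_ge0 h0 (normr_ge0 x).
  by nra.
Qed.

End Truncation.

(** * Increments of odd powers *)

Section PowerInequality.
Variable R : realDomainType.
Implicit Types a b : R.

(** Replacing the smaller of [|a|], [|b|] by the larger one turns the monomial into a pure even
    power. *)
Lemma norm_monomial_le a b k i : (i <= k.*2)%N ->
  a ^+ (k.*2 - i) * b ^+ i <= a ^+ k.*2 + b ^+ k.*2.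
Proof.
move=> ik; apply: le_trans (ler_norm _) _; rewrite normrM !normrX.
have ev (x : R) : x ^+ k.*2 = `|x| ^+ k.*2.
  by rewrite -mul2n !exprM real_normK ?num_real.
rewrite (ev a) (ev b); set x := `|a|; set y := `|b|.
have x0 : 0 <= x := normr_ge0 a.
have y0 : 0 <= y := normr_ge0 b.
have [xy|yx] := leP x y.
  apply: (@le_trans _ _ (y ^+ k.*2)); last by rewrite lerDr exprn_ge0.
  rewrite -{2}(subnK ik) exprD ler_wpM2r ?exprn_ge0 //.
  by rewrite lerXn2r ?nnegrE.
apply: (@le_trans _ _ (x ^+ k.*2)); last by rewrite lerDl exprn_ge0.
rewrite -{2}(subnK ik) exprD ler_wpM2l ?exprn_ge0 //.
by rewrite lerXn2r ?nnegrE // ltW.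
Qed.

(** Factoring out [a - b] leaves [2 k + 1] monomials of degree [2 k], each bounded by the sum of the
    two pure powers. *)
Lemma subr_mul_subrXX_le a b k :
  (a - b) * (a ^+ k.*2.+1 - b ^+ k.*2.+1)
  <= (a - b) ^+ 2 * (k.*2.+1%:R * a ^+ k.*2 + k.*2.+1%:R * b ^+ k.*2).
Proof.
rewrite subrXX mulrA -expr2 ler_wpM2l ?sqr_ge0 //.
rewrite -mulrDr mulr_natl -[in leRHS](card_ord k.*2.+1) -sumr_const.
by apply: ler_sum => i _; rewrite norm_monomial_le // -ltnS.
Qed.

End PowerInequality.

(** * Moments, tails and small-ball estimate by exchangeable pairs *)

Section Concentration.
Variables (R : realType) (m : nat) (mu : probability (MxBorel R m) R).
Hypothesis haar : haar_Om mu.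
Variables (A : 'M[R]_m) (d : R) (b : 'cV[R]_m).
Hypotheses (m_gt0 : (0 < m)%N) (A_sym : A^T = A) (A_diag : forall i, A i i = d).
Hypothesis A01 : forall v, 0 <= qform A v <= dot v v.
Hypothesis b1 : dot b b = 1.
Local Notation D := (@orthogonal_mx R m : set (MxBorel R m)).
Local Notation E := (Ex mu).
Local Notation bounded_rv := (@bounded_mfun _ _ R D).

Definition centred_qform (U : MxBorel R m) : R := qform A ((U : 'M[R]_m) *m b) - d.
Local Notation f := centred_qform.

Lemma dot_orthogonal_b U : D U -> dot ((U : 'M[R]_m) *m b) ((U : 'M[R]_m) *m b) = 1.
Proof. by move=> [UU _]; rewrite dot_orthogonal. Qed.

Lemma bounded_rv_centred_qform : bounded_rv f.
Proof.
split.
  apply: measurable_funB; last exact: measurable_cst.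
  rewrite (_ : (fun U : MxBorel R m => _) = (fun U : MxBorel R m =>
    \sum_i \sum_j A i j * ((\sum_k (U : 'M[R]_m) i k * b k 0)
                         * (\sum_k (U : 'M[R]_m) j k * b k 0)))).
    apply: measurable_sum => i; apply: measurable_sum => j.
    apply: measurable_funM; first exact: measurable_cst.
    by apply: measurable_funM; apply: measurable_sum => k;
      (apply: measurable_funM; [exact: measurable_coord | exact: measurable_cst]).
  by apply/funext => U; rewrite -qform_sum; apply: eq_bigr => i _;
    apply: eq_bigr => j _; rewrite !mxE.
exists (1 + `|d|) => U DU; apply: le_trans (ler_normB _ _) _.
rewrite lerD2r; have /andP[q0] := A01 ((U : 'M[R]_m) *m b).
by rewrite dot_orthogonal_b // ger0_norm.
Qed.
Local Hint Resolve bounded_rv_centred_qform : core.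

Section Rotations.
Variables c s : R.
Hypotheses (cs : c ^+ 2 + s ^+ 2 = 1) (c_lt1 : 0 < 1 - c).
Hypothesis c_small : 48 * m%:R * (1 - c) <= 1.
Local Notation G := (givens c s).

Lemma orthogonal_mx_givens (i j : 'I_m) : j != i -> orthogonal_mx (G i j).
Proof.
move=> ji; split; rewrite givens_tr; apply: givens_orthogonal => //.
by rewrite eq_sym.
Qed.

Lemma givens_mulK i j (U : 'M[R]_m) : j != i -> G i j *m (G j i *m U) = U.
Proof. by move=> ji; rewrite mulmxA givens_orthogonal ?mul1mx // eq_sym. Qed.

Lemma bounded_rv_givens i j (Z : MxBorel R m -> R) : j != i ->
  bounded_rv Z -> bounded_rv (fun U : MxBorel R m => Z (G i j *m (U : 'M[R]_m))).
Proof. by move=> ji; apply: bounded_rv_mulmxl; exact: orthogonal_mx_givens. Qed.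

Lemma sum_givens_centred U : D U ->
  \sum_(i < m) \sum_(j < m | j != i) (f U - f (G i j *m (U : 'M[R]_m)))
  = 4 * (1 - c) * (m%:R - (1 - c)) * f U.
Proof.
move=> DU; rewrite -(sum_givens_qform A_sym A_diag cs (dot_orthogonal_b DU)).
apply: eq_bigr => i _; apply: eq_bigr => j _.
by rewrite /f mulmxA; ring.
Qed.

Lemma sum_givens_centred_sqr U : D U ->
  \sum_(i < m) \sum_(j < m | j != i) (f U - f (G i j *m (U : 'M[R]_m))) ^+ 2
  <= 50 * (1 - c).
Proof.
move=> DU.
have := sum_givens_qform_sqr A_sym A01 cs (dot_orthogonal_b DU) (ltW c_lt1) c_small.
apply: le_trans; rewrite le_eqVlt; apply/orP; left; apply/eqP.
apply: eq_bigr => i _; apply: eq_bigr => j _; congr (_ ^+ 2).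
by rewrite /f mulmxA; ring.
Qed.

Lemma ler_sum_offdiag (T : 'I_m -> 'I_m -> R) i j : (forall k l, 0 <= T k l) ->
  j != i -> T i j <= \sum_(k < m) \sum_(l < m | l != k) T k l.
Proof.
move=> T0 ji; rewrite (bigD1 i) //= (bigD1 j) //= -addrA lerDl addr_ge0 //.
  exact: sumr_ge0.
by apply: sumr_ge0 => k _; exact: sumr_ge0.
Qed.

Lemma sum_offdiag_sym (T : 'I_m -> 'I_m -> R) :
  \sum_(i < m) \sum_(j < m | j != i) (T i j + T j i)
  = 2 * \sum_(i < m) \sum_(j < m | j != i) T i j.
Proof.
under eq_bigr => i _ do rewrite big_split /=.
rewrite big_split /= [X in _ + X](exchange_big_dep xpredT) //=.
rewrite mulr_natl mulr2n; congr (_ + _); apply: eq_bigr => i _.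
by apply: eq_bigl => j; rewrite eq_sym.
Qed.

(* (U, G_ij U) is an exchangeable pair once averaged over the ordered pairs
   (i, j), because G_ij and G_ji are inverse to each other. *)
Lemma exchangeable_pair (phi : R -> R) : bounded_rv (phi \o f) ->
  4 * (1 - c) * (m%:R - (1 - c)) * E (fun U => f U * phi (f U))
  = 2^-1 * \sum_(i < m) \sum_(j < m | j != i)
     E (fun U => (f U - f (G i j *m (U : 'M[R]_m)))
               * (phi (f U) - phi (f (G i j *m (U : 'M[R]_m))))).
Proof.
move=> bphi.
pose T i j := E (fun U => (f U - f (G i j *m (U : 'M[R]_m))) * phi (f U)).
have bd i j : j != i ->
    bounded_rv (fun U : MxBorel R m => f U - f (G i j *m (U : 'M[R]_m))).
  by move=> ji; apply: bounded_mfunB => //; exact: bounded_rv_givens.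
have bG i j : j != i ->
    bounded_rv (fun U : MxBorel R m => phi (f (G i j *m (U : 'M[R]_m)))).
  by move=> ji; apply: (@bounded_rv_givens i j (phi \o f)).
have -> : \sum_(i < m) \sum_(j < m | j != i)
     E (fun U => (f U - f (G i j *m (U : 'M[R]_m)))
               * (phi (f U) - phi (f (G i j *m (U : 'M[R]_m)))))
     = \sum_(i < m) \sum_(j < m | j != i) (T i j + T j i).
  apply: eq_bigr => i _; apply: eq_bigr => j ji.
  have ij : i != j by rewrite eq_sym.
  (* Invariance under the rotation inverse to [G i j] exchanges the roles of [U] and the rotated
     matrix. *)
  have -> : T j i = E (fun U => (f (G i j *m (U : 'M[R]_m)) - f U)
                             * phi (f (G i j *m (U : 'M[R]_m)))).
    rewrite -[RHS](Ex_mulmxl haar (orthogonal_mx_givens ij)); last first.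
      apply: bounded_mfunM; last exact: bG.
      by apply: bounded_mfunB => //; exact: bounded_rv_givens.
    by apply: eq_Ex => U DU; rewrite givens_mulK.
  rewrite -ExD //; last 2 first.
  - by apply: bounded_mfunM; [exact: bd | exact: bphi].
  - apply: bounded_mfunM; last exact: bG.
    by apply: bounded_mfunB => //; exact: bounded_rv_givens.
  by apply: eq_Ex => U DU; ring.
rewrite (sum_offdiag_sym T).
(* Moving the sums inside the expectation makes the eigenvector identity applicable pointwise. *)
have -> : \sum_(i < m) \sum_(j < m | j != i) T i j
     = 4 * (1 - c) * (m%:R - (1 - c)) * E (fun U => f U * phi (f U)).
  rewrite -ExZ //; last by apply: bounded_mfunM.
  under eq_bigr => i _.
    rewrite -Ex_sum //; last first.
      by move=> j ji; apply: bounded_mfunM; [exact: bd | exact: bphi].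
    over.
  rewrite -Ex_sum //; last first.
    move=> i _; apply: bounded_mfun_sum => j ji.
    by apply: bounded_mfunM; [exact: bd | exact: bphi].
  apply: eq_Ex => U DU; under eq_bigr => i _ do rewrite -mulr_suml.
  by rewrite -mulr_suml sum_givens_centred // mulrA.
by field.
Qed.

(** The exchange of [U] with its rotation turns the two weights into twice one of them, which
    factors out of the sum of squared increments; hence 100, twice 50. *)
Lemma sum_givens_weighted (psi : R -> R) : bounded_rv (psi \o f) ->
  (forall x, 0 <= psi x) ->
  \sum_(i < m) \sum_(j < m | j != i)
     E (fun U => (f U - f (G i j *m (U : 'M[R]_m))) ^+ 2
               * (psi (f U) + psi (f (G i j *m (U : 'M[R]_m)))))
  <= 100 * (1 - c) * E (psi \o f).
Proof.
move=> bpsi psi0.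
pose T i j := E (fun U => (f U - f (G i j *m (U : 'M[R]_m))) ^+ 2 * psi (f U)).
have bd i j : j != i ->
    bounded_rv (fun U : MxBorel R m => (f U - f (G i j *m (U : 'M[R]_m))) ^+ 2).
  move=> ji; apply: bounded_mfunX; apply: bounded_mfunB => //.
  exact: bounded_rv_givens.
have bd' i j : j != i ->
    bounded_rv (fun U : MxBorel R m => (f (G i j *m (U : 'M[R]_m)) - f U) ^+ 2).
  move=> ji; apply: bounded_mfunX; apply: bounded_mfunB => //.
  exact: bounded_rv_givens.
have bG i j : j != i ->
    bounded_rv (fun U : MxBorel R m => psi (f (G i j *m (U : 'M[R]_m)))).
  by move=> ji; apply: (@bounded_rv_givens i j (psi \o f)).
have bT i j : j != i ->
    bounded_rv (fun U => (f U - f (G i j *m (U : 'M[R]_m))) ^+ 2 * psi (f U)).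
  by move=> ji; apply: bounded_mfunM; [exact: bd | exact: bpsi].
have -> : \sum_(i < m) \sum_(j < m | j != i)
     E (fun U => (f U - f (G i j *m (U : 'M[R]_m))) ^+ 2
               * (psi (f U) + psi (f (G i j *m (U : 'M[R]_m)))))
     = \sum_(i < m) \sum_(j < m | j != i) (T i j + T j i).
  apply: eq_bigr => i _; apply: eq_bigr => j ji.
  have ij : i != j by rewrite eq_sym.
  have -> : T j i = E (fun U => (f (G i j *m (U : 'M[R]_m)) - f U) ^+ 2
                             * psi (f (G i j *m (U : 'M[R]_m)))).
    rewrite -[RHS](Ex_mulmxl haar (orthogonal_mx_givens ij)); last first.
      by apply: bounded_mfunM; [exact: bd' | exact: bG].
    by apply: eq_Ex => U DU; rewrite givens_mulK.
  rewrite -ExD //; [|exact: bT|by apply: bounded_mfunM; [exact: bd' | exact: bG]].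
  by apply: eq_Ex => U DU; ring.
rewrite (sum_offdiag_sym T).
suff : \sum_(i < m) \sum_(j < m | j != i) T i j <= 50 * (1 - c) * E (psi \o f)
  by lra.
rewrite -ExZ //.
under eq_bigr => i _.
  rewrite -Ex_sum //; last by move=> j ji; exact: bT.
  over.
have bS i : bounded_rv (fun U : MxBorel R m =>
    \sum_(j < m | j != i) (f U - f (G i j *m (U : 'M[R]_m))) ^+ 2 * psi (f U)).
  by apply: bounded_mfun_sum => j; exact: bT.
rewrite -Ex_sum //; apply: le_Ex => //.
- exact: bounded_mfun_sum.
- exact: bounded_mfunZ.
move=> U DU; under eq_bigr => i _ do rewrite -mulr_suml.
by rewrite -mulr_suml ler_wpM2r //; exact: sum_givens_centred_sqr.
Qed.

(** A single squared increment is at most the whole sum, so a small angle makes every step of [f]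
    small. *)
Lemma norm_givens_centred i j U : j != i -> D U ->
  (f U - f (G i j *m (U : 'M[R]_m))) ^+ 2 <= 50 * (1 - c).
Proof.
move=> ji DU; apply: le_trans (sum_givens_centred_sqr DU).
apply: (@ler_sum_offdiag
  (fun i j => (f U - f (G i j *m (U : 'M[R]_m))) ^+ 2)) => // k l.
exact: sqr_ge0.
Qed.

End Rotations.

(** A form of Stein's method: the exchangeable-pair identity bounds [E(f phi(f))] by the squared
    increments weighted by [psi]. Both sides carry the factor [1 - c], which cancels, so one fixed
    small angle suffices and no limit is taken. *)
Lemma dirichlet_bound (dl : R) (phi psi : R -> R) : 0 < dl ->
  bounded_rv (phi \o f) -> bounded_rv (psi \o f) -> (forall x, 0 <= psi x) ->
  (forall x y, `|x - y| <= dl ->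
     (x - y) * (phi x - phi y) <= (x - y) ^+ 2 * (psi x + psi y)) ->
  m%:R * E (fun U => f U * phi (f U)) <= 25 * E (psi \o f).
Proof.
move=> dl0 bphi bpsi psi0 phipsi.
have m0 : 1 <= m%:R :> R by rewrite ler1n.
(* [tau] is [1 - c]. The first bound makes the sum of squares estimate available, the second forces
   increments of [f] to be at most [dl]. *)
pose tau := Num.min ((48 * m%:R)^-1) (dl ^+ 2 / 50).
have tau0 : 0 < tau.
  by rewrite lt_min invr_gt0 divr_gt0 ?exprn_gt0 ?mulr_gt0 // ltr0n.
have tau1 : 48 * m%:R * tau <= 1.
  rewrite mulrC -ler_pdivlMr ?mulr_gt0 ?ltr0n // mul1r.
  by rewrite ge_min lexx.
have tau2 : 50 * tau <= dl ^+ 2.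
  by rewrite mulrC -ler_pdivlMr // ge_min lexx orbT.
have tau3 : tau <= 2^-1.
  have : 1 * tau <= m%:R * tau := ler_wpM2r (ltW tau0) m0.
  by move: tau1; lra.
pose c := 1 - tau; pose s := Num.sqrt (1 - c ^+ 2).
have cs : c ^+ 2 + s ^+ 2 = 1.
  rewrite sqr_sqrtr; first by rewrite addrC subrK.
  by rewrite subr_ge0 expr_le1 // /c; lra.
have cE : 1 - c = tau by rewrite /c; ring.
have c1 : 0 < 1 - c by rewrite cE.
have c2 : 48 * m%:R * (1 - c) <= 1 by rewrite cE.
have H1 := exchangeable_pair cs bphi.
have H2 := sum_givens_weighted cs c1 c2 bpsi psi0.
have H3 : \sum_(i < m) \sum_(j < m | j != i)
     E (fun U => (f U - f (givens c s i j *m (U : 'M[R]_m)))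
               * (phi (f U) - phi (f (givens c s i j *m (U : 'M[R]_m)))))
   <= \sum_(i < m) \sum_(j < m | j != i)
     E (fun U => (f U - f (givens c s i j *m (U : 'M[R]_m))) ^+ 2
               * (psi (f U) + psi (f (givens c s i j *m (U : 'M[R]_m))))).
  apply: ler_sum => i _; apply: ler_sum => j ji.
  have bf := bounded_rv_givens cs ji bounded_rv_centred_qform.
  have bp := bounded_rv_givens cs ji bphi.
  have bq := bounded_rv_givens cs ji bpsi.
  apply: le_Ex => //.
  - by apply: bounded_mfunM; apply: bounded_mfunB.
  - by apply: bounded_mfunM; [apply: bounded_mfunX; apply: bounded_mfunB|
                              apply: bounded_mfunD].
  move=> U DU; apply: phipsi.
  rewrite -(@ler_pXn2r _ 2) ?nnegrE ?(ltW dl0) // real_normK ?num_real //.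
  by apply: le_trans (norm_givens_centred cs c1 c2 ji DU) _; rewrite cE.
set X := E (fun U => f U * phi (f U)) in H1 *.
set Y := E (psi \o f) in H2 *.
have Y0 : 0 <= Y by apply: Ex_ge0 => U _; exact: psi0.
have {}H1 : 4 * tau * (m%:R - tau) * X <= 50 * tau * Y.
  by move: H1 H2 H3; rewrite cE; lra.
have {}H1 : (m%:R - tau) * X <= 25 / 2 * Y.
  rewrite -(ler_pM2l (_ : 0 < 4 * tau)); last by rewrite mulr_gt0.
  by lra.
(* For nonnegative [X], [tau <= 1/2] gives [m - tau >= m / 2], which doubles the constant 25/2. *)
have [X0|X0] := ltP X 0.
  apply: (@le_trans _ _ 0); last by rewrite mulr_ge0.
  by rewrite mulr_ge0_le0 // ltW.
have : 2^-1 * m%:R * X <= (m%:R - tau) * X by rewrite ler_wpM2r //; lra.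
lra.
Qed.

(** Testing against the power [2 k + 1] bounds [m] times the moment of order [2 k + 2] by
    [25 (2 k + 1) <= 50 (k + 1)] times that of order [2 k]; then induction. *)
Lemma even_moment_le k :
  E (fun U => f U ^+ k.*2) <= k`!%:R * (50 / m%:R) ^+ k.
Proof.
have m0 : 0 < m%:R :> R by rewrite ltr0n.
elim: k => [|k IH].
  rewrite expr0 mulr1 fact0 -[leRHS](Ex_cst haar 1).
  by rewrite (@eq_Ex _ _ _ _ (cst 1)) // => U _; rewrite double0 expr0.
(* The step size 1 is arbitrary: the power inequality holds at any distance. *)
have := @dirichlet_bound 1 (fun x => x ^+ k.*2.+1)
          (fun x => k.*2.+1%:R * x ^+ k.*2) ltr01 _ _ _ _.
rewrite /comp ExZ //; last exact: bounded_mfunX.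
move=> H.
have {}H : m%:R * E (fun U => f U ^+ k.+1.*2)
    <= 25 * (k.*2.+1%:R * E (fun U => f U ^+ k.*2)).
  rewrite -[X in _ * X <= _](_ : E (fun U => f U * f U ^+ k.*2.+1) = _); last first.
    by apply: eq_Ex => U _; rewrite -exprS.
  apply: H.
  - exact: bounded_mfunX.
  - by apply: bounded_mfunZ; exact: bounded_mfunX.
  - by move=> x; rewrite mulr_ge0 // -muln2 exprM sqr_ge0.
  - by move=> x y _; exact: subr_mul_subrXX_le.
have M0 : 0 <= E (fun U => f U ^+ k.*2).
  by apply: Ex_ge0 => U _; rewrite -muln2 exprM sqr_ge0.
have k1 : k.*2.+1%:R <= 2 * k.+1%:R :> R.
  by rewrite -natrM ler_nat mul2n doubleS.
rewrite -(ler_pM2l m0); apply: le_trans H _.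
apply: (@le_trans _ _ (50 * k.+1%:R * E (fun U => f U ^+ k.*2))).
  have := ler_wpM2r M0 k1; lra.
apply: (@le_trans _ _ (50 * k.+1%:R * (k`!%:R * (50 / m%:R) ^+ k))).
  by rewrite ler_wpM2l // mulr_ge0.
rewrite factS natrM exprS le_eqVlt; apply/orP; left; apply/eqP.
by field; rewrite gt_eqF.
Qed.

Definition near_mean (t : R) : set (MxBorel R m) := D `&` [set U | `|f U| <= t].
Definition far_from_mean (t : R) : set (MxBorel R m) := D `&` [set U | t < `|f U|].

Lemma measurable_near_mean t : measurable (near_mean t).
Proof.
apply: measurableI; first exact: measurable_orthogonal_mx.
have [mf _] := bounded_mfun_norm bounded_rv_centred_qform.
have := mf measurableT `]-oo, t]%classic (measurable_itv _).
by rewrite setTI; congr measurable.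
Qed.

Lemma measurable_far_from_mean t : measurable (far_from_mean t).
Proof.
apply: measurableI; first exact: measurable_orthogonal_mx.
have [mf _] := bounded_mfun_norm bounded_rv_centred_qform.
have := mf measurableT `]t, +oo[%classic (measurable_itv _).
rewrite setTI; congr measurable.
by apply/seteqP; split => U /=; rewrite in_itv /= andbT.
Qed.

Lemma near_far_mean t : E \1_(near_mean t) + E \1_(far_from_mean t) = 1.
Proof.
have mN := measurable_near_mean t; have mF := measurable_far_from_mean t.
rewrite -ExD //; [|exact: bounded_mfun_indic|exact: bounded_mfun_indic].
rewrite -[RHS](Ex_cst haar 1); apply: eq_Ex => U DU.
rewrite !indicE /=; case: (leP `|f U| t) => ft.
  rewrite mem_set // memNset ?addr0 // => -[_ /=].
  by rewrite ltNge ft.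
rewrite memNset ?mem_set ?add0r // => -[_ /=].
by rewrite leNgt ft.
Qed.

(** Markov's inequality for [exp(m f^2 / 100)]: by the moment bounds its [k]-th term has expectation
    at most [2^-k], so the whole is at most 2. *)
Lemma tail_bound (t : R) : 0 <= t ->
  E \1_(far_from_mean t) <= 2 * expR (- (m%:R * t ^+ 2 / 100)).
Proof.
move=> t0; set p := E _; set x := m%:R * t ^+ 2 / 100.
have m0 : 0 < m%:R :> R by rewrite ltr0n.
have bF : bounded_rv \1_(far_from_mean t).
  by apply: bounded_mfun_indic; exact: measurable_far_from_mean.
have p0 : 0 <= p by apply: Ex_ge0 => U _; rewrite indicE.
have x0 : 0 <= x by rewrite divr_ge0 ?mulr_ge0 ?sqr_ge0 // ltW.
(* Working with partial sums of the exponential means that only finite sums are exchanged with the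
   expectation. *)
have partial N : series (exp_coeff x) N * p <= 2.
  rewrite -ExZ //.
  pose g k (U : MxBorel R m) := (m%:R / 100) ^+ k / k`!%:R * f U ^+ k.*2.
  have bg k : bounded_rv (g k) by apply: bounded_mfunZ; exact: bounded_mfunX.
  apply: (@le_trans _ _ (E (fun U => \sum_(0 <= k < N) g k U))).
    apply: le_Ex => //; first exact: bounded_mfunZ.
      by apply: bounded_mfun_sum.
    move=> U DU; rewrite indicE; have [|_] := boolP (U \in _); last first.
      rewrite mulr0; apply: sumr_ge0 => k _; rewrite /g -muln2 exprM.
      by rewrite mulr_ge0 ?sqr_ge0 // divr_ge0 // exprn_ge0 // divr_ge0 // ltW.
    rewrite inE => -[_ /= tf]; rewrite mulr1; apply: ler_sum => k _.
    rewrite /exp_coeff /= /g /x -mul2n exprM -[m%:R * _ / _]mulrAC exprMn.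
    rewrite [leRHS]mulrAC ler_wpM2r ?invr_ge0 //.
    apply: ler_wpM2l; first by rewrite exprn_ge0 // divr_ge0 // ltW.
    rewrite lerXn2r ?nnegrE ?sqr_ge0 // -[leRHS]real_normK ?num_real //.
    by rewrite lerXn2r ?nnegrE // ltW.
  rewrite Ex_sum //.
  apply: (@le_trans _ _ (series (geometric 1 2^-1) N)).
    apply: ler_sum => k _; rewrite /g ExZ //; last exact: bounded_mfunX.
    apply: (@le_trans _ _ ((m%:R / 100) ^+ k / k`!%:R * (k`!%:R * (50 / m%:R) ^+ k))).
      apply: ler_wpM2l; last exact: even_moment_le.
      by rewrite divr_ge0 // exprn_ge0 // divr_ge0 // ltW.
    rewrite mulrA divfK; last by rewrite pnatr_eq0 -lt0n fact_gt0.
    rewrite -exprMn /geometric /= mul1r le_eqVlt; apply/orP; left; apply/eqP.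
    by congr (_ ^+ k); field; rewrite gt_eqF.
  rewrite geometric_seriesE /=; last by lra.
  have : 0 <= 2^-1 ^+ N :> R by rewrite exprn_ge0.
  have -> : 1 * (1 - 2^-1 ^+ N) / (1 - 2^-1) = 2 * (1 - 2^-1 ^+ N) :> R.
    by field.
  lra.
rewrite expRN ler_pdivlMr ?expR_gt0 // mulrC.
have [->|p_neq0] := eqVneq p 0; first by rewrite mulr0.
have {p_neq0}p_gt0 : 0 < p by rewrite lt_def p_neq0.
rewrite -ler_pdivlMr //; apply: limr_le; first exact: is_cvg_series_exp_coeff.
by apply: nearW => N; rewrite ler_pdivlMr.
Qed.

(* Small-ball estimate around the mean: Stein's identity is tested against the
   truncation of f at height dl, whose increments live where f is small. *)
Lemma small_ball (dl : R) : 0 < dl ->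
  m%:R * (dl * (E (fun U => `|f U|) - dl)) <= 25 / 2 * E \1_(near_mean (3 * dl)).
Proof.
move=> dl0.
pose phi : R -> R := truncate dl.
(* A bump equal to 1 up to [2 dl] and to 0 from [3 dl] on: it covers the places where the truncation
   can move and lies below the indicator of the event. *)
pose h (x : R) : R := Num.max 0 (Num.min 1 (3 - `|x| / dl)).
have bphi : bounded_rv (phi \o f).
  apply: bounded_mfun_max; first exact: bounded_mfun_cst.
  by apply: bounded_mfun_min => //; exact: bounded_mfun_cst.
have bh : bounded_rv (h \o f).
  apply: bounded_mfun_max; first exact: bounded_mfun_cst.
  apply: bounded_mfun_min; first exact: bounded_mfun_cst.
  apply: bounded_mfunB; first exact: bounded_mfun_cst.
  by apply: bounded_mfunM; [exact: bounded_mfun_norm | exact: bounded_mfun_cst].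
have h0 x : 0 <= h x by rewrite le_max lexx.
have bh2 : bounded_rv ((fun x => 2^-1 * h x) \o f) by exact: bounded_mfunZ.
have h1 x y : `|x - y| <= dl -> phi x != phi y -> h x = 1.
  move=> xy pxy; suff xdl : `|x| <= 2 * dl.
    have : `|x| / dl <= 2 by rewrite ler_pdivrMr.
    by rewrite /h /Num.max /Num.min => ?; do 2 case: ifP; lra.
  rewrite leNgt; apply/negP => xdl; move/eqP: pxy; apply.
  exact: (truncate_far (ltW dl0) xy xdl).
have lip x y : `|phi x - phi y| <= `|x - y| := truncate_lip x y (ltW dl0).
(* If the truncation moves, both values of [h] are 1, so half of each suffices; this yields 25/2
   instead of 25. *)
have step x y : `|x - y| <= dl ->
   (x - y) * (phi x - phi y) <= (x - y) ^+ 2 * (2^-1 * h x + 2^-1 * h y).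
  move=> xy; have [->|pxy] := eqVneq (phi x) (phi y).
    by rewrite subrr mulr0 mulr_ge0 ?sqr_ge0 // addr_ge0 // mulr_ge0.
  rewrite (h1 x y) // (h1 y x) 1?distrC 1?eq_sym //.
  have -> : 2^-1 * 1 + 2^-1 * 1 = 1 :> R by field.
  rewrite mulr1; apply: le_trans (ler_norm _) _.
  rewrite normrM -real_normK ?num_real // expr2.
  exact: ler_wpM2l.
have H : m%:R * E (fun U => f U * phi (f U)) <= 25 / 2 * E (h \o f).
  have -> : 25 / 2 * E (h \o f) = 25 * E ((fun x => 2^-1 * h x) \o f).
    by rewrite /comp ExZ // mulrA.
  by apply: (dirichlet_bound dl0) => // x; rewrite mulr_ge0.
apply: (@le_trans _ _ (m%:R * E (fun U => f U * phi (f U)))).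
  rewrite ler_wpM2l //.
  have bn : bounded_rv (fun U => `|f U|) by exact: bounded_mfun_norm.
  have -> : dl * (E (fun U => `|f U|) - dl)
      = E (fun U => dl * `|f U| - cst (dl ^+ 2) U).
    rewrite ExB //; [|exact: bounded_mfunZ|exact: bounded_mfun_cst].
    by rewrite Ex_cst // ExZ //; ring.
  apply: le_Ex => //.
  - by apply: bounded_mfunB; [exact: bounded_mfunZ | exact: bounded_mfun_cst].
  - exact: bounded_mfunM.
  by move=> U DU /=; apply: truncate_mul_ge; exact: ltW.
apply: le_trans H _; rewrite ler_wpM2l //; apply: le_Ex => //.
  by apply: bounded_mfun_indic; exact: measurable_near_mean.
move=> U DU /=; rewrite indicE; have [_|Uf] := boolP (U \in _).
  by rewrite /h ge_max ler01 ge_min lexx.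
have : 3 * dl < `|f U|.
  rewrite ltNge; apply: contra Uf => fU; rewrite inE; split => //.
rewrite -ltr_pdivlMr // => fU.
by rewrite /h max_l // ge_min; apply/orP; right; lra.
Qed.

Lemma near_mean_mono (s t : R) : s <= t -> E \1_(near_mean s) <= E \1_(near_mean t).
Proof.
move=> st; apply: le_Ex => //.
- by apply: bounded_mfun_indic; exact: measurable_near_mean.
- by apply: bounded_mfun_indic; exact: measurable_near_mean.
move=> U DU; rewrite !indicE ler_nat.
have [|//] := boolP (U \in near_mean s); rewrite inE => -[_ /= fs].
by rewrite mem_set //; split => //=; exact: le_trans st.
Qed.

(** If [E|f| <= t / 2], Markov's inequality gives probability at least 1/2. Otherwise [small_ball]
    at [dl = t / 6] applies: [E|f| - dl] exceeds [t / 3], so [m t^2 / 18] is at most 25/2 times the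
    probability. *)
Lemma near_mean_lower (t : R) : 0 < t ->
  Num.min (2^-1) (m%:R * t ^+ 2 / 225) <= E \1_(near_mean t).
Proof.
move=> t0; set e := E (fun U => `|f U|).
have m0 : 0 < m%:R :> R by rewrite ltr0n.
have [te|te] := leP (2 * e) t.
  rewrite ge_min; apply/orP; left.
  suff : E \1_(far_from_mean t) <= 2^-1 by have := near_far_mean t; lra.
  have bF : bounded_rv \1_(far_from_mean t).
    by apply: bounded_mfun_indic; exact: measurable_far_from_mean.
  rewrite -(ler_pM2l t0) -ExZ //; apply: (@le_trans _ _ e); last by lra.
  apply: le_Ex => //; [exact: bounded_mfunZ|exact: bounded_mfun_norm|].
  move=> U DU; rewrite indicE; have [|_] := boolP (U \in _); last by rewrite mulr0.
  by rewrite inE => -[_ /= tf]; rewrite mulr1 ltW.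
rewrite ge_min; apply/orP; right.
have dl0 : 0 < t / 6 by rewrite divr_gt0.
have := small_ball dl0; rewrite -/e.
have := @near_mean_mono (3 * (t / 6)) t ltac:(lra).
have : m%:R * (t / 6 * (t / 3)) <= m%:R * (t / 6 * (e - t / 6)).
  by rewrite !ler_pM2l //; lra.
have -> : m%:R * t ^+ 2 / 225 = 2 / 25 * (m%:R * (t / 6 * (t / 3))) by field.
lra.
Qed.

(** With [x = m t^2], for [x >= 200] part of the exponent absorbs the factor 2 of the tail bound, as
    [1/100 = 1/450 + 7/900]. For smaller [x], [1 - exp(- x / 450) <= x / 450] lies below both terms
    of the lower bound near the mean. *)
Theorem concentration (t : R) : 0 < t ->
  1 - expR (- (m%:R * t ^+ 2 / 450)) <= E \1_(near_mean t).
Proof.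
move=> t0; set x := m%:R * t ^+ 2.
have x0 : 0 < x by rewrite mulr_gt0 ?exprn_gt0 ?ltr0n.
have [x200|x200] := leP 200 x.
  suff : E \1_(far_from_mean t) <= expR (- (x / 450)).
    by have := near_far_mean t; lra.
  apply: le_trans (tail_bound (ltW t0)) _; rewrite -/x.
  have e2 : 2 <= expR (7 * x / 900) by apply: le_trans (expR_ge1Dx _); lra.
  have -> : - (x / 450) = 7 * x / 900 + - (x / 100) by field.
  by rewrite expRD ler_wpM2r // expR_ge0.
apply: le_trans (near_mean_lower t0); rewrite -/x.
have := expR_ge1Dx (- (x / 450)).
by rewrite le_min => ?; apply/andP; split; lra.
Qed.

End Concentration.

(** * Fourier inversion for the spectral density *)

Section SymmetricSums.
Variable R : realType.
Implicit Types a : int -> R.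

Lemma symsumS a N :
  symsum a N.+1 = symsum a N + (a N.+1%:Z + a (- N.+1%:Z)).
Proof.
rewrite /symsum addnS addSn big_ord_recl big_ord_recr /=.
rewrite addrCA; congr (_ + _).
  by apply: eq_bigr => i _; congr a; rewrite /bump; lia.
by rewrite addrC; congr (a _ + a _); rewrite /bump; lia.
Qed.

(** Pairing the indices [k] and [- k] turns symmetric partial sums into those of an ordinary series,
    with a shift by one. *)
Definition symterm a (k : nat) : R :=
  if k is n.+1 then a n.+1%:Z + a (- n.+1%:Z) else a 0.

Lemma symsum_series a N : symsum a N = series (symterm a) N.+1.
Proof.
elim: N => [|N IH]; last first.
  by rewrite symsumS IH [in RHS]/series /= big_nat_recr.
by rewrite /symsum /series /= big_ord1 big_nat1.
Qed.

Lemma cvgn_symsum a : cvgn (symsum a) <-> cvgn (series (symterm a)).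
Proof.
have E : symsum a = [sequence series (symterm a) n.+1]_n.
  by apply/funext => N; exact: symsum_series.
split => /cvg_ex[l al]; apply/cvg_ex; exists l.
  by rewrite -cvg_shiftS -E.
by rewrite E cvg_shiftS.
Qed.

Lemma abs_summable_cvg a : abs_summable a -> cvgn (symsum a).
Proof.
move=> /cvgn_symsum sa; apply/cvgn_symsum; apply: normed_cvg.
have s0 k : 0 <= symterm (fun t => `|a t|) k.
  by case: k => [|k] //=; exact: addr_ge0.
apply: series_le_cvg sa => // -[|k] //=.
exact: ler_normD.
Qed.

Lemma le_symsum_norm a N : abs_summable a ->
  symsum (fun t => `|a t|) N <= limn (symsum (fun t => `|a t|)).
Proof.
move=> sa; apply: nondecreasing_cvgn_le => //.
by apply/nondecreasing_seqP => n; rewrite symsumS lerDl addr_ge0.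
Qed.

Lemma norm_symsum_le a b N : (forall t, `|a t| <= b t) ->
  `|symsum a N| <= symsum b N.
Proof.
move=> ab; apply: le_trans (ler_norm_sum _ _ _) _.
by apply: ler_sum => i _; exact: ab.
Qed.

Lemma symsum_delta a (n : int) N : (`|n| <= N)%N ->
  symsum (fun t => a t * (t == n)%:R) N = a n.
Proof.
move=> nN; rewrite /symsum.
have kN : (`|(n + N%:Z)%R| < (N + N).+1)%N by lia.
rewrite (bigD1 (Ordinal kN)) //= (_ : _ - N%:Z = n); last by lia.
rewrite eqxx mulr1 big1 ?addr0 // => i ik.
have /eqP : i != Ordinal kN by [].
case: eqP => [iN|]; last by rewrite mulr0.
by case; apply: val_inj => /=; lia.
Qed.

Lemma symsumZ c a N : symsum (fun t => c * a t) N = c * symsum a N.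
Proof. by rewrite /symsum mulr_sumr. Qed.

Lemma symsumD a b N : symsum (fun t => a t + b t) N = symsum a N + symsum b N.
Proof. by rewrite /symsum big_split. Qed.

End SymmetricSums.

(** * Orthogonality of cosines over one period *)

Section Harmonics.
Variable R : realType.
Local Notation I := (@freqI R).
Local Notation bddI := (@bounded_mfun _ (measurableTypeR R) R I).
Local Notation mu := (@lebesgue_measure R).
Implicit Types (c nu : R) (f g : R -> R) (n k : int).

Definition harmonic (n : int) (nu : R) : R := cos (2 * pi * nu * n%:~R).

Lemma measurable_freqI : measurable (I : set (measurableTypeR R)).
Proof. exact: measurable_itv. Qed.

Lemma lebesgue_freqI : mu I = 1%E.
Proof.
rewrite /freqI lebesgue_measure_itv /= lte_fin ifT; last by lra.
by rewrite -EFinD opprK; congr EFin; field.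
Qed.

Lemma lebesgue_freqI_lty : (mu I < +oo)%E.
Proof. by rewrite lebesgue_freqI ltry. Qed.

Lemma avgIE f : avgI f = Rintegral mu I f.
Proof. by []. Qed.

Lemma avgI_cst c : avgI (cst c) = c.
Proof.
rewrite avgIE Rintegral_cst; last exact: measurable_freqI.
by rewrite -[X in fine X]/(mu I) lebesgue_freqI mulr1.
Qed.

Lemma harmonicE n nu : harmonic n nu = cos (2 * pi * n%:~R * nu).
Proof. by rewrite /harmonic mulrAC. Qed.

Lemma continuous_harmonic n : continuous (harmonic n).
Proof.
move=> x; apply: continuous_comp; last exact: continuous_cos.
apply: cvgM; last exact: cvg_cst.
by apply: cvgM; [exact: cvg_cst | exact: cvg_id].
Qed.

Lemma bounded_harmonic n : bddI (harmonic n).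
Proof.
split; first by apply: continuous_measurable_fun; exact: continuous_harmonic.
by exists 1 => x _; exact: cos_max.
Qed.

Lemma harmonic0 nu : harmonic 0 nu = 1.
Proof. by rewrite /harmonic mulr0 cos0. Qed.

Lemma harmonicN n : harmonic (- n) = harmonic n.
Proof. by apply/funext => nu; rewrite /harmonic mulrNz mulrN cosN. Qed.

Lemma harmonicM n k nu : harmonic n nu * harmonic k nu
  = 2^-1 * (harmonic (n - k) nu + harmonic (n + k) nu).
Proof.
rewrite /harmonic intrB intrD mulrBr (mulrDr _ n%:~R k%:~R) cosB cosD.
by field.
Qed.

Lemma sin_pi_nat (n : nat) : sin (pi *+ n) = 0 :> R.
Proof. by rewrite -[pi *+ n]add0r (alternatingn (@sinDpi R)) sin0 mulr0. Qed.

(** For nonzero [n] the primitive, a multiple of the sine of [2 pi n nu], vanishes at both ends of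
    the interval. *)
Lemma avgI_harmonic n : avgI (harmonic n) = (n == 0)%:R.
Proof.
wlog : n / exists k : nat, n = k%:Z.
  move=> H; case: n => k; first by apply: H; exists k.
  by rewrite NegzE harmonicN H ?oppr_eq0 //; exists k.+1.
move=> [[|k] ->].
  rewrite eqxx (_ : harmonic _ = cst 1) ?avgI_cst //.
  by apply/funext => nu; rewrite harmonic0.
pose w : R := 2 * pi * k.+1%:R.
have w0 : w != 0 by rewrite !mulf_neq0 // ?pnatr_eq0 // gt_eqF // pi_gt0.
pose F (x : R) := w^-1 * sin (w * x).
have dF (x : R) : is_derive x 1 F (harmonic k.+1%:Z x).
  rewrite harmonicE -/w.
  have d1 : is_derive x 1 (fun y : R => w * y) w.
    by apply: is_derive_eq; rewrite /GRing.scale /= mulr1.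
  have d2 := is_derive1_comp (is_derive_sin (w * x)) d1.
  have d3 : is_derive x 1 (w^-1 *: (sin \o (fun y : R => w * y)))
      (w^-1 *: (cos (w * x) * w)).
    exact: is_deriveZ.
  apply: is_derive_eq d3 _; rewrite /GRing.scale /=.
  by rewrite mulrCA mulVf // mulr1.
have cF x : {for x, continuous F}.
  by apply: differentiable_continuous; apply/derivable1_diffP; case: (dF x).
rewrite /avgI /freqI (continuous_FTC2 (F := F)).
- rewrite -EFinB /= /F.
  have e : w * 2^-1 = pi *+ k.+1 by rewrite /w -mulr_natr; field.
  by rewrite mulrN sinN e sin_pi_nat oppr0 mulr0 subrr.
- by lra.
- by apply: continuous_subspaceT; exact: continuous_harmonic.
- split.
  + by move=> x _; case: (dF x).
  + by apply: cvg_at_right_filter; exact: cF.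
  + by apply: cvg_at_left_filter; exact: cF.
- by move=> x _; rewrite derive1E; case: (dF x).
Qed.

Lemma avgID f g : bddI f -> bddI g ->
  avgI (fun x => f x + g x) = avgI f + avgI g.
Proof.
move=> bf bg; apply: RintegralD; first exact: measurable_freqI.
  exact: (bounded_mfun_integrable measurable_freqI lebesgue_freqI_lty).
exact: (bounded_mfun_integrable measurable_freqI lebesgue_freqI_lty).
Qed.

Lemma avgIZ c f : bddI f -> avgI (fun x => c * f x) = c * avgI f.
Proof.
move=> bf; apply: RintegralZl; first exact: measurable_freqI.
exact: (bounded_mfun_integrable measurable_freqI lebesgue_freqI_lty).
Qed.

Lemma avgI_sum J (r : seq J) (F : J -> R -> R) :
  (forall j, bddI (F j)) ->
  avgI (fun x => \sum_(j <- r) F j x) = \sum_(j <- r) avgI (F j).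
Proof.
move=> bF; apply: Rintegral_sum; first exact: measurable_freqI.
by move=> j _; exact: (bounded_mfun_integrable measurable_freqI lebesgue_freqI_lty).
Qed.

Lemma le_avgI f g : bddI f -> bddI g ->
  (forall x, I x -> f x <= g x) -> avgI f <= avgI g.
Proof.
move=> bf bg fg; rewrite !avgIE; apply: le_Rintegral => //.
- exact: measurable_freqI.
- exact: (bounded_mfun_integrable measurable_freqI lebesgue_freqI_lty).
- exact: (bounded_mfun_integrable measurable_freqI lebesgue_freqI_lty).
Qed.

Lemma avgI_harmonicM n k : avgI (fun nu => harmonic n nu * harmonic k nu)
  = 2^-1 * ((n == k)%:R + (n == - k)%:R).
Proof.
rewrite (_ : (fun nu => _) = (fun nu =>
    2^-1 * (harmonic (n - k) nu + harmonic (n + k) nu))); last first.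
  by apply/funext => nu; rewrite harmonicM.
have b1 := bounded_harmonic (n - k); have b2 := bounded_harmonic (n + k).
rewrite avgIZ ?avgID ?avgI_harmonic ?subr_eq0 ?addr_eq0 //.
exact: bounded_mfunD.
Qed.

End Harmonics.
Arguments measurable_freqI {R}.
Arguments lebesgue_freqI_lty {R}.

(** * Fourier coefficients of the spectral density *)

Section PowerSpectralDensity.
Variables (R : realType) (C : int -> R).
Hypothesis C_sum : abs_summable C.
Local Notation I := (@freqI R).
Local Notation bddI := (@bounded_mfun _ (measurableTypeR R) R I).
Local Notation mu := (@lebesgue_measure R).
Local Notation partial N := (fun nu => symsum (fun t => C t * harmonic t nu) N).

(** Domination by the series of [|C t|] makes the limit in the definition of [psd] a genuine one. *)
Lemma psd_cvg nu : (fun N => partial N nu) @ \oo --> psd C nu.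
Proof.
apply: abs_summable_cvg; apply/cvgn_symsum.
have ge0 (a : int -> R) k : 0 <= symterm (fun t => `|a t|) k.
  by case: k => [|k] //=; rewrite addr_ge0.
have /cvgn_symsum := C_sum; apply: series_le_cvg => // k.
have le t : `|C t * harmonic t nu| <= `|C t|.
  by rewrite normrM ler_piMr // cos_max.
by case: k => [|k] /=; rewrite ?lerD ?le.
Qed.

Lemma norm_partial_psd N nu :
  `|partial N nu| <= limn (symsum (fun t => `|C t|)).
Proof.
apply: le_trans (le_symsum_norm N C_sum); apply: norm_symsum_le => t.
by rewrite normrM ler_piMr // cos_max.
Qed.

Lemma norm_psd nu : `|psd C nu| <= limn (symsum (fun t => `|C t|)).
Proof.
have h : `|partial N nu| @[N --> \oo] --> `|psd C nu|.
  by apply: cvg_norm; exact: psd_cvg.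
rewrite -(cvg_lim (@Rhausdorff R) h); apply: limr_le.
  by apply/cvg_ex; exists `|psd C nu|; exact: h.
by apply: nearW => N; exact: norm_partial_psd.
Qed.

Lemma bounded_partial_psd N : bddI (partial N).
Proof.
apply: bounded_mfun_sum => i _; apply: bounded_mfunZ.
exact: bounded_harmonic.
Qed.

Lemma bounded_psd : bddI (psd C).
Proof.
split; last by exists (limn (symsum (fun t => `|C t|))) => nu _; exact: norm_psd.
apply: (measurable_fun_cvg (h := fun N => partial N)).
  by move=> N; have [] := bounded_partial_psd N.
by move=> nu _; exact: psd_cvg.
Qed.

Hypothesis C_even : forall t, C (- t) = C t.

(** Orthogonality selects the indices [n] and [- n] with weight one half each; evenness of [C]
    merges them, also when [n = 0]. *)
Lemma avgI_partial_psd_harmonic n N : (`|n| <= N)%N ->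
  avgI (fun nu => partial N nu * harmonic n nu) = C n.
Proof.
move=> nN.
transitivity (symsum (fun t => C t * (2^-1 * ((t == n)%:R + (t == - n)%:R))) N).
  rewrite (_ : (fun nu => _) = (fun nu => \sum_(i < (N + N).+1)
      C (i%:Z - N%:Z) * (harmonic (i%:Z - N%:Z) nu * harmonic n nu))); last first.
    by apply/funext => nu; rewrite /symsum mulr_suml;
      apply: eq_bigr => i _; rewrite mulrA.
  rewrite avgI_sum => [|i]; last first.
    by apply: bounded_mfunZ; apply: bounded_mfunM; exact: bounded_harmonic.
  apply: eq_bigr => i _; rewrite avgIZ ?avgI_harmonicM //.
  by apply: bounded_mfunM; exact: bounded_harmonic.
rewrite (_ : (fun t => _) = (fun t =>
    2^-1 * (C t * (t == n)%:R + C t * (t == - n)%:R))).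
  rewrite symsumZ symsumD !symsum_delta ?abszN // C_even.
  by field.
by apply/funext => t; ring.
Qed.

(** Dominated convergence, with the constant total sum of [|C t|] as majorant; the integrals of the
    partial sums are constant once [N >= |n|]. *)
Lemma avgI_psd_harmonic n : avgI (fun nu => psd C nu * harmonic n nu) = C n.
Proof.
set B := limn (symsum (fun t => `|C t|)).
suff E : (\int[mu]_(nu in I) (psd C nu * harmonic n nu)%:E = (C n)%:E)%E.
  by rewrite /avgI E.
have H := @dominated_cvg _ (measurableTypeR R) R mu I measurable_freqI
    (fun N nu => (partial N nu * harmonic n nu)%:E)
    (fun nu => (psd C nu * harmonic n nu)%:E) (cst B%:E) _ _ _ _ _.
apply: (cvg_unique _ (H _ _ _ _ _)); first exact: ereal_hausdorff.
- move=> N; apply/measurable_EFinP; apply: measurable_funTS.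
  by have [] := bounded_mfunM (bounded_partial_psd N) (bounded_harmonic R n).
- move=> nu _; apply: cvg_EFin; first exact: nearW.
  by apply: cvgM; [exact: psd_cvg | exact: cvg_cst].
- by [].
- apply: (bounded_mfun_integrable measurable_freqI lebesgue_freqI_lty).
  exact: bounded_mfun_cst.
- move=> N nu _; rewrite /= lee_fin normrM.
  apply: (@le_trans _ _ (`|partial N nu|)); last exact: norm_partial_psd.
  by rewrite ler_piMr // cos_max.
apply: cvg_near_cst; exists `|n|%N => // N /= nN.
rewrite -(avgI_partial_psd_harmonic nN) /avgI fineK //.
apply: integrable_fin_num; first exact: measurable_freqI.
apply: (bounded_mfun_integrable measurable_freqI lebesgue_freqI_lty).
by apply: bounded_mfunM; [exact: bounded_partial_psd | exact: bounded_harmonic].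
Qed.

Lemma avgI_psd : avgI (psd C) = C 0.
Proof.
rewrite -avgI_psd_harmonic; congr avgI; apply/funext => nu.
by rewrite harmonic0 mulr1.
Qed.

(** * Input and output power of an FIR filter as quadratic forms *)

Section Filter.
Variable m : nat.
Implicit Types v : 'cV[R]_m.

Definition toeplitz : 'M[R]_m := \matrix_(k, l) C (k%:Z - l%:Z).

Lemma toeplitz_sym : toeplitz^T = toeplitz.
Proof. by apply/matrixP => k l; rewrite !mxE -C_even opprB. Qed.

Lemma toeplitz_diag k : toeplitz k k = C 0.
Proof. by rewrite mxE subrr. Qed.

(** The squared modulus of the transfer function, expanded by the formula for the cosine of a
    difference. *)
Lemma fir_gain2E v nu : fir_gain2 v nu
  = \sum_(k < m) \sum_(l < m) v k 0 * v l 0 * harmonic (k%:Z - l%:Z) nu.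
Proof.
rewrite /fir_gain2 !expr2 -!sum2_mul -sum2D.
apply: eq_bigr => k _; apply: eq_bigr => l _.
by rewrite /harmonic intrB mulrBr cosB -!pmulrn; ring.
Qed.

Lemma bounded_fir_gain2 v : bddI (fir_gain2 v).
Proof.
rewrite (_ : fir_gain2 v = fun nu => \sum_(k < m) \sum_(l < m)
   v k 0 * v l 0 * harmonic (k%:Z - l%:Z) nu); last first.
  by apply/funext => nu; exact: fir_gain2E.
apply: bounded_mfun_sum => k _; apply: bounded_mfun_sum => l _.
by apply: bounded_mfunZ; exact: bounded_harmonic.
Qed.

(** Parseval's identity: only the terms with [k = l] survive averaging. *)
Lemma avgI_fir_gain2 v : avgI (fir_gain2 v) = dot v v.
Proof.
rewrite (_ : fir_gain2 v = fun nu => \sum_(k < m) \sum_(l < m)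
   v k 0 * v l 0 * harmonic (k%:Z - l%:Z) nu); last first.
  by apply/funext => nu; exact: fir_gain2E.
have bh k l : bddI (fun nu => v k 0 * v l 0 * harmonic (k%:Z - l%:Z) nu).
  by apply: bounded_mfunZ; exact: bounded_harmonic.
rewrite avgI_sum => [|k]; last by apply: bounded_mfun_sum.
apply: eq_bigr => k _; rewrite avgI_sum // (bigD1 k) //=.
rewrite avgIZ ?avgI_harmonic; last exact: bounded_harmonic.
rewrite subrr eqxx mulr1 big1 ?addr0 // => l lk.
rewrite avgIZ ?avgI_harmonic; last exact: bounded_harmonic.
by rewrite subr_eq0 eqz_nat eq_sym (negPf lk : (l == k :> nat) = false) mulr0.
Qed.

Lemma avgI_psd_fir_gain2 v :
  avgI (fun nu => psd C nu * fir_gain2 v nu) = qform toeplitz v.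
Proof.
rewrite (_ : (fun nu => _) = fun nu => \sum_(k < m) \sum_(l < m)
   v k 0 * v l 0 * (psd C nu * harmonic (k%:Z - l%:Z) nu)); last first.
  apply/funext => nu; rewrite fir_gain2E mulr_sumr; apply: eq_bigr => k _.
  by rewrite mulr_sumr; apply: eq_bigr => l _; rewrite mulrCA.
have bp k l : bddI (fun nu => psd C nu * harmonic (k%:Z - l%:Z) nu).
  by apply: bounded_mfunM; [exact: bounded_psd | exact: bounded_harmonic].
rewrite avgI_sum => [|k]; last first.
  by apply: bounded_mfun_sum => l _; exact: bounded_mfunZ.
rewrite -qform_sum; apply: eq_bigr => k _.
rewrite avgI_sum => [|l]; last exact: bounded_mfunZ.
by apply: eq_bigr => l _; rewrite avgIZ // avgI_psd_harmonic mxE mulrC.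
Qed.

Lemma psd_le_sup nu : I nu -> psd C nu <= sup [set psd C nu | nu in I].
Proof.
move=> Inu; apply: ub_le_sup; last by exists nu.
exists (limn (symsum (fun t => `|C t|))) => _ [x _ <-].
exact: le_trans (ler_norm _) (norm_psd x).
Qed.

(** The form is the average of the density against the nonnegative gain, whose own average is the
    squared norm. *)
Lemma qform_toeplitz_le v :
  qform toeplitz v <= sup [set psd C nu | nu in I] * dot v v.
Proof.
rewrite -avgI_psd_fir_gain2 -avgI_fir_gain2.
have bg := bounded_fir_gain2 v.
rewrite -avgIZ //; apply: le_avgI.
- by apply: bounded_mfunM => //; exact: bounded_psd.
- exact: bounded_mfunZ.
move=> nu Inu; rewrite ler_wpM2r ?psd_le_sup //.
by rewrite addr_ge0 // sqr_ge0.
Qed.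

End Filter.
End PowerSpectralDensity.

(** * Spectral dependency ratio *)

Section WeakStationarity.
Variables (R : realType) (d : measure_display) (Omega : measurableType d).
Variables (P : probability Omega R) (X : int -> {RV P >-> R}) (C : int -> R).
Hypothesis X_ws : weakly_stationary X C.

(** Stationarity read at the times [t] and 0 gives the same product of variables in the other
    order. *)
Lemma autocov_even t : C (- t) = C t.
Proof.
have [_ [_ [_ XX]]] := X_ws.
apply: EFin_inj; rewrite -(XX t) -(XX 0 t); congr expectation.
by apply/funext => w; rewrite subrr add0r mulrC.
Qed.

Lemma expectation_sqr : ('E_P[fun w => ((X (0:int) w) ^+ 2)%R] = (C 0)%:E)%E.
Proof.
have [_ [_ [_ XX]]] := X_ws; rewrite -(XX 0 0).
by rewrite (_ : (fun w => X 0 w * X (0 + 0) w) = (fun w => X 0 w ^+ 2)).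
Qed.

Lemma integrable_prod s t :
  P.-integrable setT (EFin \o (fun w => X s w * X t w)).
Proof.
have [_ [X2 _]] := X_ws.
apply: (le_integrable measurableT _ _ (integrableD measurableT (X2 s) (X2 t))).
  by apply/measurable_EFinP; apply: measurable_funM.
move=> w _ /=; rewrite lee_fin [leRHS]ger0_norm ?addr_ge0 ?sqr_ge0 // ler_norml.
have := sqr_ge0 (X s w - X t w); have := sqr_ge0 (X s w + X t w).
have := sqr_ge0 (X s w); have := sqr_ge0 (X t w).
by move=> *; apply/andP; split; nra.
Qed.

Lemma Rintegral_prod s t : Rintegral P setT (fun w => X s w * X t w) = C (s - t).
Proof.
have [_ [_ [_ XX]]] := X_ws.
have := XX s (t - s); rewrite addrC subrK unlock => H.
by rewrite /Rintegral H /= -autocov_even opprB.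
Qed.

(** The form is the second moment of the linear combination of the process with coefficients [v]. *)
Lemma qform_toeplitz_ge0 m (v : 'cV[R]_m) : 0 <= qform (toeplitz C m) v.
Proof.
have iZ k l : P.-integrable setT
    (EFin \o (fun w => v k 0 * v l 0 * (X k%:Z w * X l%:Z w))).
  have := integrableZl measurableT (v k 0 * v l 0) (integrable_prod k%:Z l%:Z).
  by [].
have -> : qform (toeplitz C m) v = Rintegral P setT
    (fun w => \sum_(k < m) \sum_(l < m) v k 0 * v l 0 * (X k%:Z w * X l%:Z w)).
  rewrite -qform_sum Rintegral_sum //; last first.
    move=> k _; rewrite (_ : _ \o _ = (fun w =>
      \sum_(l < m) (v k 0 * v l 0 * (X k%:Z w * X l%:Z w))%:E)%E).
      by apply: integrable_sum => // l _; exact: iZ.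
    by apply/funext => w /=; rewrite sumEFin.
  apply: eq_bigr => k _; rewrite Rintegral_sum //.
  apply: eq_bigr => l _; rewrite RintegralZl //; last exact: integrable_prod.
  by rewrite Rintegral_prod mxE mulrC.
apply: Rintegral_ge0 => w _.
have -> : \sum_(k < m) \sum_(l < m) v k 0 * v l 0 * (X k%:Z w * X l%:Z w)
    = (\sum_(k < m) v k 0 * X k%:Z w) ^+ 2.
  rewrite expr2 -sum2_mul; apply: eq_bigr => k _; apply: eq_bigr => l _.
  by ring.
exact: sqr_ge0.
Qed.

End WeakStationarity.

(** The gain of [U b] averages to [|b|^2] by orthogonality, and this factor is absorbed by
    normalising [b]. *)
Lemma sdr_qform (R : realType) (C : int -> R) m (U : 'M[R]_m) (b : 'cV[R]_m) :
  abs_summable C -> (forall t, C (- t) = C t) ->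
  orthogonal_mx U -> b != 0 ->
  sdr C U b = qform (toeplitz C m) (U *m ((Num.sqrt (dot b b))^-1 *: b)) / C 0.
Proof.
move=> C_sum C_even [UU _] b0; have bb := dot_gt0 b0.
rewrite /sdr avgI_psd_fir_gain2 // avgI_psd // avgI_fir_gain2.
rewrite dot_orthogonal // -scalemxAr qformZ exprVn sqr_sqrtr ?ltW //.
by rewrite invfM mulrA mulrAC [_ / dot b b]mulrC.
Qed.

Theorem mainTheorem2 (R : realType) :
  exists kappa : R, 0 < kappa /\
  forall (d : measure_display) (Omega : measurableType d)
         (P : probability Omega R) (X : int -> {RV P >-> R}) (C : int -> R),
  weakly_stationary X C ->
  abs_summable C ->
  (0 < 'E_P[fun w => ((X (0:int) w) ^+ 2)%R])%E ->
  forall (m : nat), (1 <= m)%N ->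
  forall (b : 'cV[R]_m), b != 0 ->
  forall (mu : probability (MxBorel R m) R), haar_Om mu ->
  forall eps : R, 0 < eps ->
  exists A : set (MxBorel R m), measurable A /\
    (forall U : MxBorel R m, A U ->
       `|sdr C U b - 1| <=
         2 * eps / fine ('E_P[fun w => ((X (0:int) w) ^+ 2)%R])%E *
         sup [set psd C nu | nu in @freqI R]) /\
    ((1 - expR (- (kappa * (m%:R - 1) * eps ^+ 2)))%:E <= mu A)%E.
Proof.
(* The concentration rate 1/450 at [t = 2 eps] gives [4 / 450]. *)
exists (2 / 225); split; first by rewrite divr_gt0.
move=> d Omega P X C X_ws C_sum + m m_gt0 b b0 mu haar eps eps0.
have C_even := autocov_even X_ws.
rewrite (expectation_sqr X_ws) lte_fin /= => C0.
set M := sup _.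
(* The power [C 0] is the average of the spectral density, hence at most its supremum. *)
have M0 : 0 < M.
  apply: (lt_le_trans C0); rewrite -[leLHS](avgI_psd C_sum C_even) -[leRHS]avgI_cst.
  apply: le_avgI; [exact: bounded_psd|exact: bounded_mfun_cst|].
  by move=> nu; exact: psd_le_sup.
(* Dividing by [M] puts the form between 0 and the squared norm; [b] is scaled to unit length. *)
pose T := M^-1 *: toeplitz C m; pose b' := (Num.sqrt (dot b b))^-1 *: b.
have T_sym : T^T = T by rewrite /T linearZ /= toeplitz_sym.
have T_diag k : T k k = M^-1 * C 0 by rewrite mxE toeplitz_diag.
have T01 v : 0 <= qform T v <= dot v v.
  rewrite qform_scale mulr_ge0 ?invr_ge0 ?(ltW M0) ?(qform_toeplitz_ge0 X_ws) //=.
  by rewrite ler_pdivrMl // qform_toeplitz_le.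
have b'1 : dot b' b' = 1.
  have bb := dot_gt0 b0.
  by rewrite dotZl dotZr mulrA -invfM -expr2 sqr_sqrtr ?ltW // mulVf // gt_eqF.
(* On this event the unnormalised form is within [2 eps M] of [C 0]; dividing by [C 0] gives the
   claimed deviation. *)
exists (near_mean T (M^-1 * C 0) b' (2 * eps)); split.
  exact: measurable_near_mean.
split.
  move=> U [oU /=]; rewrite /centred_qform qform_scale -mulrBr normrM.
  rewrite ger0_norm ?invr_ge0 ?(ltW M0) // ler_pdivrMl // mulrC => fU.
  rewrite (sdr_qform C_sum C_even oU b0) -/b'.
  have -> : qform (toeplitz C m) (U *m b') / C 0 - 1
      = (qform (toeplitz C m) (U *m b') - C 0) / C 0.
    by field; rewrite gt_eqF.
  rewrite normrM normfV (gtr0_norm C0) ler_pdivrMr //.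
  have -> : 2 * eps / C 0 * M * C 0 = 2 * eps * M by field; rewrite gt_eqF.
  by [].
rewrite -Ex_indic //; first last.
- by move=> U [].
- exact: measurable_near_mean.
rewrite lee_fin; apply: le_trans (concentration haar m_gt0 T_sym T_diag T01 b'1 _);
  last by rewrite mulr_gt0.
(* Replacing [m] by [m - 1] only weakens the exponent. *)
rewrite lerD2l lerN2 ler_expR lerN2.
have -> : m%:R * (2 * eps) ^+ 2 / 450 = 2 / 225 * m%:R * eps ^+ 2 by field.
by rewrite ler_wpM2r ?sqr_ge0 // ler_wpM2l // gerBl.
Qed.
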